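(* Let $K$ be a compact semisimple Lie group with Cartan subalgebra $\mathfrak t$, let $\Delta^+(K)$ be the set of positive roots, $\{\lambda\}$ the set of fundamental weights, $W$ the Weyl group, $m$ the number of simple roots, and $\rho$ the half sum of the positive roots. Then $$\frac{1}{z^\rho z_1^\rho\prod_{\alpha\in\Delta^+(K)}(1-z^{-\alpha})(1-z_1^{-\alpha})}\sum_{w,v\in W}\frac{(-1)^{m+\sigma(w)+\sigma(v)}}{\prod_\lambda(1-z^{-w\lambda}z_1^{-v\lambda})}$$ $$=\sum_{w,v\in W}\frac{1}{\prod_{\alpha\in\Delta^+(K)}(1-z^{-w\alpha})\ \prod_\lambda(1-z^{w\lambda}z_1^{v\lambda})\ \prod_{\alpha\in\Delta^+(K)}(1-z_1^{-v\alpha})}=0 .$$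
   Context: For a linear function (character) $l$ on $\mathfrak t$, $z^l=\exp(2\pi i\,l(x))$ and $z_1^l=\exp(2\pi i\,l(y))$, where $x,y$ are $\mathfrak t$-valued differential forms of even order, e.g. $x=x'+x''$ with $x'\in\mathfrak t$ and $x''$ a $\mathfrak t$-valued curvature two-form (in particular $x,y\in\mathfrak t$ is allowed); the identities are understood wherever the denominators are invertible. Positive roots and fundamental weights are with respect to a fixed choice of Weyl chamber. $(-1)^{\sigma(w)}$ is the sign (determinant) of $w\in W$. Products $\prod_\lambda$ run over all fundamental weights. *)

(* Defs.v *)
From HB Require Import structures.
From mathcomp Require Import all_boot all_order all_algebra.
From mathcomp Require Import all_classical all_reals all_analysis.
From mathcomp Require Import finmap complex.

Set Implicit Arguments.
Unset Strict Implicit.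
Unset Printing Implicit Defensive.

Import Order.TTheory GRing.Theory Num.Theory.

Local Open Scope classical_set_scope.
Local Open Scope ring_scope.
Local Open Scope complex_scope.

HB.mixin Record Vector_isLie (R : fieldType) (g : Type) of Vector R g := {
  lie : g -> g -> g;
  lie_linearl : forall y : g, linear (fun x => lie x y);
  lie_linearr : forall x : g, linear (lie x);
  lie_alt : forall x : g, lie x x = 0;
  lie_jacobi : forall x y z : g,
    lie x (lie y z) + lie y (lie z x) + lie z (lie x y) = 0
}.

#[short(type="lieAlgType")]
HB.structure Definition LieAlgebra (R : fieldType) :=
  { g of Vector R g & Vector_isLie R g }.

Section LieAlgebras.
Variables (R : realType) (g : lieAlgType R).
Implicit Types (I t : {vspace g}).

(* Ad-invariant inner products exist on the Lie algebra of a compact group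
   (averaging); conversely, a real Lie algebra with such a product is the Lie
   algebra of a compact group. *)
Definition invariant_inner_product (B : g -> g -> R) : Prop :=
  [/\ (forall y (a : R) x x', B (a *: x + x') y = a * B x y + B x' y),
      (forall x y, B x y = B y x),
      (forall x, x != 0 -> 0 < B x x)
    & (forall x y z, B (lie x y) z = - B y (lie x z))].

Definition compact_lie : Prop := exists B, invariant_inner_product B.

Definition lie_ideal I : Prop := forall x y : g, y \in I -> lie x y \in I.

Definition lie_abelian I : Prop :=
  forall x y : g, x \in I -> y \in I -> lie x y = 0.

Definition semisimple_lie : Prop :=
  forall I, lie_ideal I -> lie_abelian I -> I = 0%VS.

(* In a compact Lie algebra the Cartan subalgebras are the maximal abelian
   ones. *)
Definition cartan_subalgebra t : Prop :=
  lie_abelian t /\ forall t', lie_abelian t' -> (t <= t')%VS -> t' = t.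

End LieAlgebras.

Section Roots.
Variables (R : realType) (g : lieAlgType R) (t : {vspace g}).
Local Notation T := (subvs_of t).
Local Notation dualT := ('Hom(subvs_of t, R^o)).
Implicit Types (a b l : dualT) (h : T).

(* [X + iY] in the complexification of [g] satisfies
   [h, X + iY] = 2 pi i a(h) (X + iY) for all h in t.  The factor 2 pi i is the
   one for which exp h acts on the root space by z^a = exp (2 pi i a(h)). *)
Definition root_vector a (X Y : g) : Prop :=
  forall h, lie (vsval h) X = - (2 * pi * a h) *: Y /\
            lie (vsval h) Y = (2 * pi * a h) *: X.

Definition roots : set dualT :=
  [set a | a != 0 /\
     exists X Y, (X != 0) || (Y != 0) /\ root_vector a X Y].

(* The coroot of a spans [g_a, g_-a], i.e. the line through
   [X + iY, X - iY] = -2i [X, Y], and is normalised by a(h) = 2. *)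
Definition coroot a : T :=
  xget 0 [set h | a h = 2 /\
    exists X Y (c : R), root_vector a X Y /\ vsval h = c *: lie X Y].

Definition reflection a : 'End(dualT) :=
  linfun (fun l : dualT => l - (l (coroot a) : R) *: a).

Inductive in_weyl : 'End(dualT) -> Prop :=
| in_weyl1 : in_weyl \1%VF
| in_weylM a w : roots a -> in_weyl w -> in_weyl (reflection a \o w)%VF.

Definition weyl_group : set 'End(dualT) := [set w | in_weyl w].

Definition weyl_sign (w : 'End(dualT)) : R :=
  \det (passmx.mxof (vbasis {:dualT}) (vbasis {:dualT}) w).

(* A Weyl chamber is represented by one of its points h0. *)
Definition regular_point h0 : Prop := forall a, roots a -> a h0 != 0.

Definition pos_roots h0 : set dualT := [set a | roots a /\ 0 < (a h0 : R)].

Definition simple_roots h0 : set dualT :=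
  [set a | pos_roots h0 a /\
     ~ exists b c, [/\ pos_roots h0 b, pos_roots h0 c & a = b + c]].

Definition fund_weights h0 : set dualT :=
  [set l | exists a, [/\ simple_roots h0 a, l (coroot a) = 1
     & forall b, simple_roots h0 b -> b != a -> l (coroot b) = 0]].

Definition rho h0 : dualT := 2^-1 *: \sum_(a <- fset_set (pos_roots h0)) a.

Definition num_simple h0 : nat := #|` fset_set (simple_roots h0)|%fset.

End Roots.

Arguments roots {R g} t.
Arguments weyl_group {R g} t.

Section EvenForms.
Variables (R : realType) (g : lieAlgType R) (t : {vspace g}).
Variable A : comUnitAlgType R[i].
Local Notation T := (subvs_of t).
Local Notation dualT := ('Hom(subvs_of t, R^o)).

Definition nilpotent (a : A) : Prop := exists n, a ^+ n = 0.

(* A plays the role of the commutative algebra of complex valued differential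
   forms of even order, where forms of positive order are nilpotent.  The form
   with body h and soul [:: (h_1, o_1); ...; (h_n, o_n)] is the element
   h (x) 1 + h_1 (x) o_1 + ... + h_n (x) o_n of the tensor product of t and A;
   an element of t is a form with empty soul. *)
Record even_form := EvenForm {
  body : T;
  soul : seq (T * A);
  soul_nilpotent : forall p, p \in soul -> nilpotent p.2
}.

Definition soul_at (x : even_form) (l : dualT) : A :=
  \sum_(p <- soul x) (l p.1 : R)%:C *: p.2.

(* The exponential series of a nilpotent element has finite support. *)
Definition nilexp (a : A) : A := \sum_(k \in [set: nat]) (k`!%:R^-1 *: a ^+ k).

Definition expi2pi (r : R) : R[i] := cos (2 * pi * r) +i* sin (2 * pi * r).

(* z^l = exp (2 pi i l(x)) *)
Definition zexp (x : even_form) (l : dualT) : A :=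
  expi2pi (l (body x)) *: nilexp ((0 +i* (2 * pi)) *: soul_at x l).

End EvenForms.

(* Main.v *)
Require Import Defs.
From HB Require Import structures.
From mathcomp Require Import all_boot all_order all_algebra.
From mathcomp Require Import all_classical all_reals all_analysis.
From mathcomp Require Import finmap complex.
From mathcomp Require Import ring lra.

(** The first equality holds term by term. With half roots,
    z^rho prod_(a > 0) (1 - z^(-a)) = prod_(a > 0) (z^(a/2) - z^(-a/2)) is a product
    of odd functions over the positive roots, and a simple reflection changes the
    sign of one factor and permutes the others; so w in the Weyl group W multiplies
    it by the determinant of w ([prod_odd_weyl], [weyl_denomE]). As rho is the sum
    of the fundamental weights ([weyl_vectorE]), pulling out
    - z^(w l) z1^(v l) from each factor 1 - z^(w l) z1^(v l) accounts for the rest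
    ([weyl_terms]).

    For the vanishing, put v = u w. For fixed u the sum over w is
    F(t) = sum_(w in W) prod_l 1 / (1 - t(w l)) for the character
    t(x) = z^(-x) z1^(-u x), and its sign is the determinant of u. The point is that
    F(t) is a constant which does not depend on t ([chamber_sum]); the double sum is
    then this constant times the sum of the determinants of the elements of W, which
    is 0 because W contains a reflection ([alternating_sum0]).

    The terms of F(t) are the generating functions of the lattice points of the
    closed Weyl chambers. A lattice point x lies in as many chambers as there are
    elements of W fixing it ([chambers_at]), whence
    sum_w [w C] = sum_u [points fixed by u] for the indicator functions. The right
    hand side is a sum of indicator functions of sublattices. Unless u fixes only 0,
    it fixes some generator w l of a chamber ([fixed_gen]), and its sublattice is
    annihilated by 1 - e^(w l). So after multiplication by the product of all factors
    1 - e^(w l) there remains, for each u fixing only 0, the indicator function of 0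
    ([chamber_sum_group_ring]); the constant is the number of these u. The identity is
    one between elements of the group ring of the weight lattice, acting on functions
    by iterated differences, and can be evaluated at any character t; invertibility
    of the factors 1 - t(w l) allows to divide. Integrality of the root system
    is essential, as it makes W act on the weight lattice.

    The facts about W which this needs, namely that the closed chamber meets each
    orbit in one point and that the stabiliser of a dominant weight fixes
    the fundamental weights occurring in it, both follow from one inequality: for
    dominant x and y the inner product of w x and y is at most that of x and y
    ([weyl_dominant_le]).

    That the roots of a compact semisimple Lie algebra form a reduced root system is
    proved in real terms: the complexification consists of pairs (X, Y), standing for
    X + i Y. The bracket of a root vector with its conjugate is a multiple of the
    vector dual to the root ([root_vector_lie]), which yields the coroot, and sl2
    theory ([string_int], [roots_reduced]) gives integrality, stability under
    reflections and reducedness. The roots span the dual of t because the operators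
    1/i ad h, which are symmetric on pairs, have common eigenvectors
    ([roots_separate]). Finally z^l is multiplicative in l since the exponential
    series of nilpotent elements is ([nilexpD]). *)

Set Implicit Arguments.
Unset Strict Implicit.
Unset Printing Implicit Defensive.

Import Order.TTheory GRing.Theory Num.Theory.
Local Open Scope classical_set_scope.
Local Open Scope ring_scope.
Local Open Scope complex_scope.

(** * Finite differences on an abelian group *)

Section Differences.
Variable E : zmodType.

(** The iterated difference at 0 of [g] along the steps in [S]: the value on [g]
    of the product of the elements 1 - e^v of the group ring of [E], for v in [S]. *)
Fixpoint fdiff (V : zmodType) (S : seq E) (g : E -> V) : V :=
  if S is v :: S' then fdiff S' (fun x => g x - g (x + v)) else g 0.

Lemma eq_fdiff (V : zmodType) S (g g' : E -> V) : g =1 g' -> fdiff S g = fdiff S g'.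
Proof. by move=> eg; congr fdiff; apply: funext. Qed.

Lemma fdiff0 (V : zmodType) S : fdiff S (fun _ : E => 0 : V) = 0.
Proof.
elim: S => [|v S IH] //=.
by rewrite -[RHS]IH; apply: eq_fdiff => x; rewrite subr0.
Qed.

Lemma fdiff_sum (V : zmodType) S I (r : seq I) (g : I -> E -> V) :
  fdiff S (fun x => \sum_(i <- r) g i x) = \sum_(i <- r) fdiff S (g i).
Proof.
elim: S g => [|v S IH] g //=.
by rewrite -IH; apply: eq_fdiff => x; rewrite sumrB.
Qed.

Lemma fdiff_cat (V : zmodType) S S' (g : E -> V) :
  fdiff (S ++ S') g = fdiff S (fun x => fdiff S' (fun y => g (x + y))).
Proof.
elim: S g => [|v S IH] g /=; first by apply: eq_fdiff => x; rewrite add0r.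
rewrite IH; apply: eq_fdiff => x.
move=> {IH}; elim: S' (g) => [|u S' IHS] h /=; first by rewrite !addr0.
transitivity (fdiff S' (fun y => (fun z => h z - h (z + u)) (x + y) -
                               (fun z => h z - h (z + u)) (x + y + v))).
  apply: eq_fdiff => y /=; rewrite !addrA (addrAC (x + y) u v).
  by rewrite !opprB addrACA [RHS]addrACA (addrC (- _)).
apply: etrans (IHS (fun z => h z - h (z + u))) _.
by congr (_ - _); apply: eq_fdiff => y; rewrite addrA.
Qed.

Lemma fdiff_rot (V : zmodType) v S S' (g : E -> V) :
  fdiff (S ++ v :: S') g = fdiff (v :: S ++ S') g.
Proof.
elim: S g => [|u S IH] g //; rewrite !cat_cons /= IH /=.
apply: eq_fdiff => x; rewrite (addrAC x u v).
by rewrite !opprB addrACA [RHS]addrACA (addrC (- _)).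
Qed.

Lemma perm_fdiff (V : zmodType) S S' (g : E -> V) :
  perm_eq S S' -> fdiff S g = fdiff S' g.
Proof.
elim: S S' g => [|v S IH] S' g pS.
  by case: S' pS => // u S' /perm_size.
have vS' : v \in S' by rewrite -(perm_mem pS) mem_head.
case/splitPr: vS' pS => S1 S2 pS.
rewrite fdiff_rot /=; apply: IH.
by rewrite -(perm_cons v) (permPl pS) -cat1s perm_catCA.
Qed.

Lemma fdiff_period (V : zmodType) v S (g : E -> V) :
  v \in S -> (forall x, g (x + v) = g x) -> fdiff S g = 0.
Proof.
move=> vS gv; rewrite (perm_fdiff _ (perm_to_rem vS)) /= -[RHS](fdiff0 _ (rem v S)).
by apply: eq_fdiff => x; rewrite gv subrr.
Qed.

Lemma fdiff_mul_period (A : pzRingType) S (h g : E -> A) :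
  (forall x v, v \in S -> h (x + v) = h x) ->
  fdiff S (fun x => h x * g x) = h 0 * fdiff S g.
Proof.
elim: S g => [|v S IH] g hS //=.
rewrite -IH => [|x u uS]; last by rewrite hS // in_cons uS orbT.
by apply: eq_fdiff => x; rewrite (hS x v) ?mem_head // mulrBr.
Qed.

Lemma fdiff_character (A : comPzRingType) S (t : E -> A) (c : A) :
  (forall x y, t (x + y) = t x * t y) ->
  fdiff S (fun x => c * t x) = c * t 0 * \prod_(v <- S) (1 - t v).
Proof.
move=> tD; elim: S c => [|v S IH] c /=; first by rewrite big_nil mulr1.
transitivity (fdiff S (fun x => (c * (1 - t v)) * t x)).
  by apply: eq_fdiff => x; rewrite tD; ring.
by rewrite IH big_cons; ring.
Qed.

(** A functional of this form is an element of the group ring of [E], acting on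
    functions with values in any abelian group by evaluation. *)
Definition group_ring_elt (L : forall V : zmodType, (E -> V) -> V) : Prop :=
  exists q : seq (int * E), forall (V : zmodType) (g : E -> V),
    L V g = \sum_(p <- q) g p.2 *~ p.1.

Lemma fdiff_group_ring S : group_ring_elt (fun V => @fdiff V S).
Proof.
elim: S => [|v S [q qP]] /=.
  by exists [:: (1, 0)] => V g; rewrite big_seq1.
exists (q ++ [seq (- p.1, p.2 + v) | p <- q]) => V g.
rewrite qP big_cat big_map /= -big_split; apply: eq_bigr => p _ /=.
by rewrite mulrzBl mulrNz.
Qed.

Lemma group_ring_eltB L L' : group_ring_elt L -> group_ring_elt L' ->
  group_ring_elt (fun V g => L V g - L' V g).
Proof.
move=> [q qP] [q' qP']; exists (q ++ [seq (- p.1, p.2) | p <- q']) => V g.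
rewrite qP qP' big_cat big_map /=; congr (_ + _).
by rewrite -sumrN; apply: eq_bigr => p _; rewrite mulrNz.
Qed.

Lemma group_ring_elt_sum I (r : seq I) (L : I -> forall V : zmodType, (E -> V) -> V) :
  (forall i, group_ring_elt (L i)) ->
  group_ring_elt (fun V g => \sum_(i <- r) L i V g).
Proof.
move=> LP; elim: r => [|i r [q qP]].
  by exists [::] => V g; rewrite !big_nil.
have [q' qP'] := LP i; exists (q' ++ q) => V g.
by rewrite big_cons big_cat qP qP'.
Qed.

(** Evaluation on the indicator function of [x] reads off the coefficient at [x]. *)
Lemma group_ring_elt_eq0 L : group_ring_elt L ->
  (forall x : E, L int (fun y => (y == x)%:R) = 0) ->
  forall (V : zmodType) (g : E -> V), L V g = 0.
Proof.
move=> [q qP] L0 V g; rewrite qP.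
transitivity (\sum_(p <- q) \sum_(x <- undup (unzip2 q))
                (if x == p.2 then g x *~ p.1 else 0)).
  rewrite big_seq [RHS]big_seq; apply: eq_bigr => p pq.
  rewrite (bigD1_seq p.2) ?undup_uniq ?mem_undup ?map_f //=.
  by rewrite eqxx big1 ?addr0 // => x /negPf ->.
rewrite exchange_big /= big1 // => x _.
transitivity (g x *~ (\sum_(p <- q) (p.2 == x)%:R *~ p.1)); last first.
  by rewrite -(qP _ (fun y => (y == x)%:R)) L0 mulr0z.
rewrite -mulrz_suml || rewrite mulrz_sumr.
apply: eq_bigr => p _; rewrite eq_sym; case: eqP => _; last by rewrite mul0rz mulr0z.
by rewrite intz.
Qed.

End Differences.

(** * Inner products and reflections *)

Lemma linfunE (R : fieldType) (U V : vectType R) (f : U -> V) :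
  linear f -> linfun f =1 f.
Proof.
move=> fl; pose F : {linear U -> V} := HB.pack f (GRing.isLinear.Build R U V _ f fl).
exact: (lfunE F).
Qed.

Definition inner_product (R : realType) (V : lmodType R) (B : V -> V -> R) : Prop :=
  [/\ forall y (a : R) x x', B (a *: x + x') y = a * B x y + B x' y,
      forall x y, B x y = B y x
    & forall x, x != 0 -> 0 < B x x].

Section InnerProduct.
Variables (R : realType) (V : lmodType R) (B : V -> V -> R).
Hypothesis BP : inner_product B.

Lemma ipC x y : B x y = B y x. Proof. by case: BP. Qed.

Lemma ipDl x x' y : B (x + x') y = B x y + B x' y.
Proof. by have [Bl _ _] := BP; rewrite -[x]scale1r Bl mul1r scale1r. Qed.

Lemma ip0l y : B 0 y = 0.
Proof. by apply: (addrI (B 0 y)); rewrite -ipDl !addr0. Qed.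

Lemma ipZl a x y : B (a *: x) y = a * B x y.
Proof. by have [Bl _ _] := BP; rewrite -[_ *: x]addr0 Bl ip0l addr0. Qed.

Lemma ipNl x y : B (- x) y = - B x y.
Proof. by rewrite -scaleN1r ipZl mulN1r. Qed.

Lemma ipBl x x' y : B (x - x') y = B x y - B x' y.
Proof. by rewrite ipDl ipNl. Qed.

Lemma ip_suml I r (P : pred I) F y :
  B (\sum_(i <- r | P i) F i) y = \sum_(i <- r | P i) B (F i) y.
Proof. exact: (big_morph (B ^~ y) (fun a b => ipDl a b y) (ip0l y)). Qed.

Lemma ipDr x x' y : B y (x + x') = B y x + B y x'.
Proof. by rewrite ipC ipDl !(ipC y). Qed.
Lemma ipZr a x y : B y (a *: x) = a * B y x.
Proof. by rewrite ipC ipZl (ipC y). Qed.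
Lemma ipNr x y : B y (- x) = - B y x. Proof. by rewrite ipC ipNl (ipC y). Qed.
Lemma ipBr x x' y : B y (x - x') = B y x - B y x'.
Proof. by rewrite ipDr ipNr. Qed.
Lemma ip_sumr I r (P : pred I) F y :
  B y (\sum_(i <- r | P i) F i) = \sum_(i <- r | P i) B y (F i).
Proof. by rewrite ipC ip_suml; apply: eq_bigr => i _; rewrite ipC. Qed.

Lemma ip_ge0 x : 0 <= B x x.
Proof.
have [-> | x0] := eqVneq x 0; first by rewrite ip0l.
by case: BP => _ _ /(_ x x0)/ltW.
Qed.

Lemma ip_eq0 x : (B x x == 0) = (x == 0).
Proof.
have [-> | x0] := eqVneq x 0; first by rewrite ip0l eqxx.
by case: BP => _ _ /(_ x x0)/gt_eqF.
Qed.

Lemma ip_gt0 x : (0 < B x x) = (x != 0).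
Proof. by rewrite lt_neqAle ip_ge0 andbT eq_sym ip_eq0. Qed.

Lemma ip_le0 x : B x x <= 0 -> x = 0.
Proof. by move=> x0; apply/eqP; rewrite -ip_eq0 eq_le x0 ip_ge0. Qed.

(** The equality case of the Cauchy-Schwarz inequality: the difference of the two
    sides has a norm which is at most 0. *)
Lemma cauchy_schwarz_eq x y :
  B x x * B y y <= B x y ^+ 2 -> B x x *: y = B x y *: x.
Proof.
move=> CS; apply/eqP; rewrite -subr_eq0; apply/eqP; apply: ip_le0.
rewrite !(ipBl, ipBr, ipZl, ipZr) (ipC y x).
have := mulr_ge0_le0 (ip_ge0 x) (_ : B x x * B y y - B x y ^+ 2 <= 0).
rewrite subr_le0 => /(_ CS) H; apply: le_trans H.
by rewrite le_eqVlt; apply/orP; left; apply/eqP; ring.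
Qed.

(** The value on [x] of the coroot of [a]. *)
Definition cart a x : R := 2 * B x a / B a a.

Lemma cartD a x y : cart a (x + y) = cart a x + cart a y.
Proof. by rewrite /cart ipDl; ring. Qed.
Lemma cartZ a r x : cart a (r *: x) = r * cart a x.
Proof. by rewrite /cart ipZl; ring. Qed.
Lemma cartN a x : cart a (- x) = - cart a x.
Proof. by rewrite /cart ipNl; ring. Qed.
Lemma cartB a x y : cart a (x - y) = cart a x - cart a y.
Proof. by rewrite cartD cartN. Qed.
Lemma cart0 a : cart a 0 = 0.
Proof. by rewrite /cart ip0l; ring. Qed.
Lemma cart_sum a I r (P : pred I) F :
  cart a (\sum_(i <- r | P i) F i) = \sum_(i <- r | P i) cart a (F i).
Proof. exact: (big_morph (cart a) (cartD a) (cart0 a)). Qed.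

Lemma cart_id a : a != 0 -> cart a a = 2.
Proof. by rewrite -ip_gt0 => a0; rewrite /cart mulfK // gt_eqF. Qed.

Lemma ip_cart a x : a != 0 -> B x a = cart a x * B a a / 2.
Proof. by rewrite -ip_gt0 => a0; rewrite /cart; field; rewrite gt_eqF. Qed.

Lemma cart_eq0 a x : a != 0 -> (cart a x == 0) = (B x a == 0).
Proof.
move=> a0; rewrite (ip_cart _ a0) !mulf_eq0 !invr_eq0 ip_eq0 (negPf a0) pnatr_eq0.
by rewrite /= !orbF.
Qed.

Lemma cart_ge0 a x : a != 0 -> (0 <= cart a x) = (0 <= B x a).
Proof.
rewrite -ip_gt0 => a0; rewrite /cart pmulr_lge0 ?invr_gt0 //.
by rewrite pmulr_rge0.
Qed.

Lemma cart_gt0 a x : a != 0 -> (0 < cart a x) = (0 < B x a).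
Proof.
rewrite -ip_gt0 => a0; rewrite /cart pmulr_lgt0 ?invr_gt0 //.
by rewrite pmulr_rgt0.
Qed.

End InnerProduct.

Section Reflections.
Variables (R : realType) (E : vectType R) (ip : E -> E -> R).
Hypothesis ipP : inner_product ip.

Definition srefl a : 'End(E) := linfun (fun x => x - cart ip a x *: a).

Lemma sreflE a x : srefl a x = x - cart ip a x *: a.
Proof.
rewrite /srefl linfunE // => r u v; rewrite cartD // cartZ //.
rewrite scalerDl scalerBr scalerA opprD !addrA; congr (_ + _).
by rewrite -!addrA; congr (_ + _); rewrite addrC.
Qed.

Lemma ip_srefl a x y : ip (srefl a x) (srefl a y) = ip x y.
Proof.
rewrite !sreflE; have [-> | a0] := eqVneq a 0; first by rewrite !scaler0 !subr0.
rewrite !(ipBl ipP, ipBr ipP, ipZl ipP, ipZr ipP) (ipC ipP a y).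
rewrite (ip_cart ipP x a0) (ip_cart ipP y a0); by field.
Qed.

Lemma srefl_id a : srefl a a = - a.
Proof.
rewrite sreflE; have [-> | a0] := eqVneq a 0; first by rewrite scaler0 subr0 oppr0.
by rewrite cart_id // scaler_nat mulr2n opprD addrA subrr add0r.
Qed.

Lemma sreflK a : involutive (srefl a).
Proof.
move=> x; have [a0 | a0] := eqVneq a 0.
  by rewrite !sreflE a0 !scaler0 !subr0.
rewrite [X in srefl a X]sreflE linearB linearZ /= srefl_id sreflE scalerN opprK.
by rewrite subrK.
Qed.

Lemma sreflN a : srefl (- a) = srefl a.
Proof.
apply/lfunP => x; rewrite !sreflE /cart !(ipNl ipP, ipNr ipP) opprK scalerN.
by congr (_ - _); rewrite -scaleNr; congr (_ *: _); rewrite mulrN mulNr opprK.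
Qed.

End Reflections.

(** The block matrix with rows (1, v) and (u, 1) factors in two ways. *)
Lemma det_1B_mul (K : comPzRingType) n (u : 'cV[K]_n) (v : 'rV[K]_n) :
  \det (1%:M - u *m v) = 1 - (v *m u) 0 0.
Proof.
pose M : 'M[K]_(1 + n) := block_mx 1%:M v u 1%:M.
have M1 : M = block_mx 1%:M 0 u 1%:M *m block_mx 1%:M v 0 (1%:M - u *m v).
  rewrite mulmx_block !(mul1mx, mulmx1, mul0mx, mulmx0, addr0, add0r).
  by rewrite addrCA subrr addr0.
have M2 : M = block_mx 1%:M v 0 1%:M *m block_mx (1%:M - v *m u) 0 u 1%:M.
  rewrite mulmx_block !(mul1mx, mulmx1, mul0mx, mulmx0, addr0, add0r).
  by rewrite subrK.
transitivity (\det M).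
  by rewrite M1 det_mulmx det_lblock det_ublock !det1 !mul1r.
rewrite M2 det_mulmx det_lblock det_ublock !det1 !mul1r mulr1 det_mx11.
by rewrite !mxE eqxx.
Qed.

Definition endo_det (R : fieldType) (E : vectType R) (w : 'End(E)) : R :=
  \det (passmx.mxof (vbasis {:E}) (vbasis {:E}) w).

Lemma endo_det1 (R : fieldType) (E : vectType R) : endo_det (\1%VF : 'End(E)) = 1.
Proof. by rewrite /endo_det passmx.mxof1 ?det1 // (basis_free (vbasisP _)). Qed.

Lemma endo_detM (R : fieldType) (E : vectType R) (v w : 'End(E)) :
  endo_det (v \o w)%VF = endo_det v * endo_det w.
Proof. by rewrite /endo_det (passmx.mxof_comp _ _ (vbasisP _)) det_mulmx mulrC. Qed.

Lemma endo_det_srefl (R : realType) (E : vectType R) (ip : E -> E -> R) a :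
  inner_product ip -> a != 0 -> endo_det (srefl ip a) = -1.
Proof.
move=> ipP a0; rewrite /endo_det; set e := vbasis {:E}.
have eB : basis_of {:E} e := vbasisP _.
pose u : 'cV_(\dim {:E}) := \col_i cart ip a e`_i; pose v := passmx.rVof e a.
have -> : passmx.mxof e e (srefl ip a) = 1%:M - u *m v.
  apply/row_matrixP => i; rewrite !rowE mulmxBr mulmx1 mulmxA.
  rewrite passmx.mul_mxof passmx.vecof_delta sreflE // -rowE.
  apply/rowP => j; rewrite !mxE linearB linearZ /= big_ord1 !mxE.
  by rewrite coord_free ?(basis_free eB) // eq_sym.
rewrite det_1B_mul; suff -> : (v *m u) 0 0 = 2 by ring.
rewrite -(cart_id ipP a0) mxE [X in _ = cart ip a X](coord_basis eB) ?memvf //.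
rewrite cart_sum //; apply: eq_bigr => i _.
by rewrite cartZ // !mxE.
Qed.

Lemma finite_set_injP (T : choiceType) (fT : finType) (f : T -> fT) (A : set T) :
  (forall x y, A x -> A y -> f x = f y -> x = y) -> finite_set A.
Proof.
move=> fI; have [-> | /set0P[x0 Ax0]] := eqVneq A set0; first exact: finite_set0.
pose g y := xget x0 [set x | A x /\ f x = y].
apply: (@sub_finite_set _ _ (g @` [set: fT])); last first.
  exact/finite_image/finite_finset.
move=> x Ax; exists (f x) => //; rewrite /g; case: xgetP => [z _ [Az fz] | /(_ x)].
  exact: fI.
by case.
Qed.

(** * Positive systems and simple roots *)

Record root_system (R : realType) (E : vectType R) (ip : E -> E -> R)
    (Phi : {fset E}) : Prop := RootSystem {
  rs_ip : inner_product ip;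
  rs_neq0 : forall a, a \in Phi -> a != 0;
  rs_refl : forall a b, a \in Phi -> b \in Phi -> srefl ip a b \in Phi;
  rs_int : forall a b, a \in Phi -> b \in Phi -> cart ip a b \is a Num.int;
  rs_red : forall a, a \in Phi -> 2 *: a \notin Phi;
  rs_span : forall x, (forall a, a \in Phi -> ip x a = 0) -> x = 0
}.

(** Such a form selects a Weyl chamber. *)
Definition regular_form (R : realType) (E : vectType R) (Phi : {fset E})
    (ev : E -> R) : Prop :=
  (forall (r : R) x y, ev (r *: x + y) = r * ev x + ev y) /\
  (forall a, a \in Phi -> ev a != 0).

Section RootSystem.
Variables (R : realType) (E : vectType R) (ip : E -> E -> R).
Variables (Phi : {fset E}) (ev : E -> R).
Hypotheses (rsP : root_system ip Phi) (evP : regular_form Phi ev).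
Local Notation c := (cart ip).
Local Notation s := (srefl ip).
Let ipP := rs_ip rsP.

Lemma evD x y : ev (x + y) = ev x + ev y.
Proof. by case: evP => evl _; rewrite -[x]scale1r evl mul1r scale1r. Qed.
Lemma ev0 : ev 0 = 0.
Proof. by apply: (addrI (ev 0)); rewrite -evD !addr0. Qed.
Lemma evZ r x : ev (r *: x) = r * ev x.
Proof. by case: evP => evl _; rewrite -[_ *: x]addr0 evl ev0 addr0. Qed.
Lemma evN x : ev (- x) = - ev x.
Proof. by rewrite -scaleN1r evZ mulN1r. Qed.
Lemma evB x y : ev (x - y) = ev x - ev y.
Proof. by rewrite evD evN. Qed.
Lemma ev_sum I r (P : pred I) F :
  ev (\sum_(i <- r | P i) F i) = \sum_(i <- r | P i) ev (F i).
Proof. exact: (big_morph ev evD ev0). Qed.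

Definition Pos : {fset E} := [fset a in Phi | 0 < ev a]%fset.
Definition Simple : {fset E} :=
  [fset a in Pos | all (fun b => a - b \notin Pos) Pos]%fset.

Lemma in_Pos a : (a \in Pos) = (a \in Phi) && (0 < ev a).
Proof. by rewrite !inE. Qed.

Lemma Pos_Phi a : a \in Pos -> a \in Phi.
Proof. by rewrite in_Pos => /andP[]. Qed.

Lemma Pos_ev a : a \in Pos -> 0 < ev a.
Proof. by rewrite in_Pos => /andP[]. Qed.

Lemma Phi_neq0 a : a \in Phi -> a != 0. Proof. exact: (rs_neq0 rsP). Qed.
Lemma Pos_neq0 a : a \in Pos -> a != 0. Proof. by move/Pos_Phi/Phi_neq0. Qed.

Lemma Phi_opp a : a \in Phi -> - a \in Phi.
Proof.
by move=> aP; rewrite -(srefl_id ipP); apply: (rs_refl rsP).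
Qed.

Lemma Phi_oppE a : (- a \in Phi) = (a \in Phi).
Proof. by apply/idP/idP => /Phi_opp //; rewrite opprK. Qed.

Lemma Phi_Pos a : a \in Phi -> a \in Pos \/ - a \in Pos.
Proof.
move=> aP; rewrite !in_Pos Phi_oppE aP evN oppr_gt0 /=; apply/orP.
by rewrite orbC -neq_lt; case: evP => _; apply.
Qed.

Lemma Pos_opp a : a \in Pos -> - a \notin Pos.
Proof. by move/Pos_ev => a0; rewrite in_Pos evN oppr_gt0 lt_gtF ?andbF. Qed.

Lemma SimpleP a : reflect
  (a \in Pos /\ ~ exists b b', [/\ b \in Pos, b' \in Pos & a = b + b'])
  (a \in Simple).
Proof.
rewrite !inE -in_Pos; apply: (iffP andP) => [[aP /allP aS]|[aP aS]]; split=> //.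
  move=> [b [b' [bP b'P ab]]]; move: (aS b bP).
  by rewrite ab [b + b']addrC addrK b'P.
apply/allP => b bP; apply/negP => abP; apply: aS; exists b, (a - b).
by split=> //; rewrite addrC subrK.
Qed.

Lemma Simple_Pos a : a \in Simple -> a \in Pos. Proof. by case/SimpleP. Qed.
Lemma Simple_Phi a : a \in Simple -> a \in Phi.
Proof. by move/Simple_Pos/Pos_Phi. Qed.
Lemma Simple_neq0 a : a \in Simple -> a != 0.
Proof. by move/Simple_Phi/Phi_neq0. Qed.

(** Height induction; the values of [ev] on the roots play the role of heights. *)
Lemma Pos_ev_ind (P : E -> Prop) :
  (forall a, a \in Pos -> (forall b, b \in Pos -> ev b < ev a -> P b) -> P a) ->
  forall a, a \in Pos -> P a.
Proof.
move=> IH a; move: {2}(count _ _).+1 (ltnSn (count (fun b => ev b < ev a) Pos)) => n.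
elim: n a => // n IHn a an aP; apply: IH => // b bP ba; apply: IHn => //.
rewrite -ltnS; apply: leq_trans an; rewrite ltnS -!size_filter.
apply: (@uniq_leq_size _ (b :: _)) => [|x] /=.
  by rewrite mem_filter ltxx filter_uniq ?fset_uniq.
rewrite in_cons mem_filter => /orP[/eqP -> | /andP[xb xP]].
  by rewrite mem_filter ba.
by rewrite mem_filter xP (lt_trans xb ba).
Qed.

Lemma Pos_ind (P : E -> Prop) :
  (forall a, a \in Simple -> P a) ->
  (forall a b, a \in Pos -> b \in Pos -> P a -> P b -> P (a + b)) ->
  forall a, a \in Pos -> P a.
Proof.
move=> PS PD; apply: Pos_ev_ind => a aP IH.
have [aS | aS] := boolP (a \in Simple); first exact: PS.
have [b [b' [bP b'P ab]]] : exists b b', [/\ b \in Pos, b' \in Pos & a = b + b'].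
  by apply: contrapT => H; case/SimpleP: aS.
have b0 := Pos_ev bP; have b'0 := Pos_ev b'P.
by rewrite ab; apply: PD => //; apply: IH => //; rewrite ab evD;
  [rewrite ltrDl | rewrite ltrDr].
Qed.

(** If b = r a with r > 0, then 2r and 2/r are positive integers with product 4,
    and 2r = 1, 2r = 4 are excluded since the double of a root is not a root. *)
Lemma Phi_pos_proportional a b r :
  a \in Phi -> b \in Phi -> 0 < r -> b = r *: a -> b = a.
Proof.
move=> aP bP r0 br; have a0 := Phi_neq0 aP; have b0 := Phi_neq0 bP.
have ab : a = r^-1 *: b by rewrite br scalerA mulVf ?scale1r // gt_eqF.
have kE : c a b = 2 * r by rewrite br cartZ // cart_id // mulrC.
have lE : c b a = 2 * r^-1 by rewrite [in LHS]ab cartZ // cart_id // mulrC.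
have /natrP[k kk] : c a b \is a Num.nat.
  by rewrite natrEint (rs_int rsP) // kE mulr_ge0 // ltW.
have /natrP[l ll] : c b a \is a Num.nat.
  by rewrite natrEint (rs_int rsP) // lE mulr_ge0 // invr_ge0 ltW.
have kl : (k * l = 4)%N.
  apply: (@mulrIn R 1) => //; rewrite ?oner_eq0 //.
  by rewrite natrM -kk -ll kE lE; field; rewrite gt_eqF.
have rk : r = k%:R / 2 by rewrite -kk kE; field.
have k4 : (k <= 4)%N by apply: dvdn_leq => //; rewrite -kl dvdn_mulr.
case: k kl rk k4 {kk} => [|[|[|[|[|k]]]]] //= kl rk _.
- have := rs_red rsP bP.
  by rewrite (_ : 2 *: b = a) ?aP // ab rk invf_div divr1.
- by rewrite br rk divff ?scale1r ?pnatr_eq0.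
- by have : (3 %| 4)%N by rewrite -kl dvdn_mulr.
- have := rs_red rsP aP.
  by rewrite (_ : 2 = r) -?br ?bP // rk; field.
Qed.

(** For an acute angle both Cartan integers would be at least 2, which forces
    equality in the Cauchy-Schwarz inequality. *)
Lemma Simple_obtuse a b : a \in Simple -> b \in Simple -> a != b -> ip a b <= 0.
Proof.
move=> aS bS anb; rewrite leNgt; apply/negP => ab0.
have aP := Simple_Phi aS; have bP := Simple_Phi bS.
have a0 := Phi_neq0 aP; have b0 := Phi_neq0 bP.
have no1 x y : x \in Simple -> y \in Simple -> c x y != 1.
  (* otherwise y - x is a root, and y or x is a sum of positive roots *)
  move=> xS yS; apply/eqP => c1.
  have := rs_refl rsP (Simple_Phi xS) (Simple_Phi yS).
  rewrite sreflE // c1 scale1r => /Phi_Pos[yxP|xyP].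
    case/SimpleP: yS => _; apply; exists (y - x), x.
    by rewrite subrK (Simple_Pos xS).
  case/SimpleP: xS => _; apply; exists y, (- (y - x)).
  by rewrite xyP (Simple_Pos yS) opprB addrC subrK.
have ge2 x y : x \in Simple -> y \in Simple -> 0 < ip y x -> ip x x <= ip y x.
  move=> xS yS xy0; have x0 := Simple_neq0 xS.
  have c0 : 0 < c x y by rewrite cart_gt0.
  rewrite (ip_cart ipP y x0) -mulrA mulrC -mulrA ler_peMr ?ip_ge0 //.
  have := no1 x y xS yS; move: c0.
  have /natrP[k ->] : c x y \is a Num.nat.
    by rewrite natrEint (rs_int rsP) ?Simple_Phi // cart_ge0 // ltW.
  rewrite ltr0n pnatr_eq1 => k0 k1.
  rewrite mulrC ler_pdivlMr // mul1r ler_nat.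
  by move: k0 k1; case: k => [|[|k]].
have CS : ip a a * ip b b <= ip a b ^+ 2.
  rewrite expr2 ler_pM ?ip_ge0 //; last exact: ge2.
  by rewrite (ipC ipP); apply: ge2; rewrite // (ipC ipP).
have := cauchy_schwarz_eq ipP CS; have aa0 : 0 < ip a a by rewrite ip_gt0.
move/(congr1 (fun x => (ip a a)^-1 *: x)).
rewrite !scalerA mulVf ?gt_eqF // scale1r => ba.
case/eqP: anb; symmetry; apply: Phi_pos_proportional ba => //.
by rewrite mulr_gt0 // invr_gt0.
Qed.

(** An obtuse family in an open half space is free: moving the negative terms of
    a linear relation to the other side gives a vector of nonpositive norm. *)
Lemma Simple_relation (n := size Simple) (a := fun i : 'I_n => nth 0 Simple i)
    (u : 'I_n -> R) :
  \sum_i u i *: a i = 0 -> forall i, u i = 0.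
Proof.
have aS i : a i \in Simple by rewrite mem_nth.
suff le0 v : \sum_i v i *: a i = 0 -> forall i, v i <= 0.
  move=> u0 i; apply: le_anti; rewrite le0 //=.
  have : - u i <= 0; last by rewrite oppr_le0.
  apply: (le0 (fun i => - u i)); transitivity (- \sum_i u i *: a i);
    last by rewrite u0 oppr0.
  by rewrite -sumrN; apply: eq_bigr => j _; rewrite scaleNr.
move=> v0.
pose y := \sum_(i | 0 < v i) v i *: a i.
have yE : y = \sum_(i | ~~ (0 < v i)) - v i *: a i.
  apply: subr0_eq; transitivity (\sum_i v i *: a i) => //.
  rewrite -sumrN [RHS](bigID (fun i => 0 < v i)) /=.
  by congr (_ + _); apply: eq_bigr => i _; rewrite scaleNr opprK.
have y0 : y = 0.
  apply: (ip_le0 ipP); rewrite {2}yE /y (ip_suml ipP).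
  apply: sumr_le0 => i vi; rewrite (ip_sumr ipP); apply: sumr_le0 => j vj.
  rewrite (ipZl ipP) (ipZr ipP); apply: mulr_ge0_le0; first exact: ltW.
  apply: mulr_ge0_le0; first by rewrite oppr_ge0 leNgt.
  apply: Simple_obtuse => //; apply: contraNneq vj => /eqP.
  by rewrite nth_uniq ?fset_uniq // => /eqP/val_inj <-.
move=> i; rewrite leNgt; apply/negP => vi.
suff : 0 < ev y by rewrite y0 ev0 ltxx.
rewrite /y ev_sum (bigD1 i) //= ltr_wpDr //; last first.
  by rewrite evZ mulr_gt0 // Pos_ev // Simple_Pos.
apply: sumr_ge0 => j /andP[vj _].
by rewrite evZ mulr_ge0 ?ltW // Pos_ev // Simple_Pos.
Qed.

(** The Gram matrix of the simple roots is invertible, hence so is the Cartan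
    matrix, whose inverse gives the fundamental weights. *)
Lemma fund_weight_exists a : a \in Simple ->
  exists l, forall b, b \in Simple -> c b l = (b == a)%:R.
Proof.
move=> aS; pose n := size Simple; pose r (i : 'I_n) := nth 0 Simple i.
have rS i : r i \in Simple by rewrite mem_nth.
pose G : 'M[R]_n := \matrix_(i, j) c (r j) (r i).
have GE (u : 'rV_n) j : (u *m G) 0 j = c (r j) (\sum_i u 0 i *: r i).
  rewrite mxE cart_sum //; apply: eq_bigr => i _.
  by rewrite mxE cartZ.
have Gu : G \in unitmx.
  rewrite -row_free_unit; apply: inj_row_free => u uG.
  apply/rowP => i; rewrite mxE; apply: (Simple_relation (u := fun i => u 0 i)).
  apply: (ip_le0 ipP); rewrite {2}(_ : \sum_i _ = \sum_i u 0 i *: r i) //.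
  rewrite (ip_sumr ipP) big1 // => j _; rewrite (ipZr ipP).
  have /eqP := GE u j; rewrite uG mxE eq_sym cart_eq0 ?Simple_neq0 // => /eqP ->.
  by rewrite mulr0.
have ia : (index a Simple < n)%N by rewrite index_mem.
pose u : 'rV_n := delta_mx 0 (Ordinal ia) *m invmx G.
exists (\sum_i u 0 i *: r i) => b bS.
have ib : (index b Simple < n)%N by rewrite index_mem.
have := GE u (Ordinal ib); rewrite /r /= nth_index // => <-.
rewrite /u mulmxKV // mxE eqxx /=; congr ((nat_of_bool _)%:R).
apply/idP/idP => [/eqP[H] | /eqP ba]; last by apply/eqP/val_inj; rewrite /= ba.
by rewrite -(nth_index 0 bS) H nth_index.
Qed.

Definition fund_weight a : E :=
  xget 0 [set l | forall b, b \in Simple -> c b l = (b == a)%:R].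

Lemma fund_weightE a b : a \in Simple -> b \in Simple -> c b (fund_weight a) = (b == a)%:R.
Proof.
move=> aS bS; have [l lP] := fund_weight_exists aS.
by rewrite /fund_weight; case: xgetP => [_ -> /(_ b bS) // | /(_ l)].
Qed.

Lemma Simple_span x : (forall a, a \in Simple -> ip x a = 0) -> x = 0.
Proof.
move=> x0; apply: (rs_span rsP) => a aP.
have posx b : b \in Pos -> ip x b = 0.
  move: b; apply: Pos_ind => // b b' _ _ bx b'x.
  by rewrite (ipDr ipP) bx b'x addr0.
by case: (Phi_Pos aP) => /posx //; rewrite (ipNr ipP) => /eqP; rewrite oppr_eq0 => /eqP.
Qed.

Lemma cart_inj x y : (forall a, a \in Simple -> c a x = c a y) -> x = y.
Proof.
move=> xy; apply/eqP; rewrite -subr_eq0; apply/eqP/Simple_span => a aS.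
by apply/eqP; rewrite -(cart_eq0 ipP _ (Simple_neq0 aS)) cartB // xy // subrr.
Qed.

Lemma fund_weight_expand x : x = \sum_(a <- Simple) c a x *: fund_weight a.
Proof.
apply: cart_inj => b bS; rewrite cart_sum // (bigD1_seq b) ?fset_uniq //=.
rewrite cartZ // fund_weightE // eqxx mulr1 big_seq_cond big1 ?addr0 // => a /andP[aS ab].
by rewrite cartZ // fund_weightE // eq_sym (negPf ab) mulr0.
Qed.

Lemma fund_weight_inj : {in Simple &, injective fund_weight}.
Proof.
move=> a b aS bS ab; have := fund_weightE aS aS; rewrite eqxx ab fund_weightE //.
by case: eqP => // _ /eqP; rewrite eq_sym oner_eq0.
Qed.

(** Pairing with [fund_weight a] computes the coefficient of the simple root [a]. *)
Lemma ip_fund_weight_Simple a b : a \in Simple -> b \in Simple ->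
  ip (fund_weight a) b = (b == a)%:R * ip a a / 2.
Proof.
move=> aS bS; rewrite (ip_cart ipP _ (Simple_neq0 bS)) fund_weightE //.
by case: eqP => [->|] //; rewrite !mul0r.
Qed.

Lemma ip_fund_weight_Pos a b : a \in Simple -> b \in Pos -> 0 <= ip (fund_weight a) b.
Proof.
move=> aS; move: b; apply: Pos_ind => [b bS | b b' _ _ b0 b'0].
  by rewrite ip_fund_weight_Simple // !mulr_ge0 ?invr_ge0 ?(ip_ge0 ipP).
by rewrite (ipDr ipP) addr_ge0.
Qed.

(** A positive root other than the simple root [a] has a positive coefficient on
    some other simple root, which the reflection in [a] does not change. *)
Lemma srefl_Pos a b : a \in Simple -> b \in Pos -> b != a -> s a b \in Pos.
Proof.
move=> aS bP ba.
have [d [dS da db]] : exists d, [/\ d \in Simple, d != a & 0 < ip (fund_weight d) b].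
  apply: contrapT => H; case/eqP: ba.
  have b0 d : d \in Simple -> d != a -> ip (fund_weight d) b = 0.
    move=> dS da; apply: le_anti; rewrite ip_fund_weight_Pos // andbT leNgt.
    by apply/negP => db; apply: H; exists d.
  have aa0 : 0 < ip a a by rewrite ip_gt0 // Simple_neq0.
  pose r := 2 * ip (fund_weight a) b / ip a a.
  have br : b = r *: a.
    apply/eqP; rewrite -subr_eq0; apply/eqP; apply: (ip_le0 ipP).
    rewrite {2}(fund_weight_expand (b - r *: a)) (ip_sumr ipP) big_seq big1 // => d dS.
    rewrite (ipZr ipP) (ipC ipP) (ipBr ipP) (ipZr ipP) (ip_fund_weight_Simple dS aS).
    have [-> | da] := eqVneq d a.
      by rewrite /= mulr1n mul1r /r; field; rewrite gt_eqF.
    by rewrite b0 // /= mul0r mul0r mulr0 subrr mulr0.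
  apply: (Phi_pos_proportional (Simple_Phi aS) (Pos_Phi bP) _ br).
  suff : 0 < ev a * r by rewrite pmulr_rgt0 // Pos_ev // Simple_Pos.
  by rewrite mulrC -evZ -br Pos_ev.
have sP := rs_refl rsP (Simple_Phi aS) (Pos_Phi bP).
case: (Phi_Pos sP) => // nP; have := ip_fund_weight_Pos dS nP.
rewrite (ipNr ipP) oppr_ge0 sreflE // (ipBr ipP) (ipZr ipP) (ip_fund_weight_Simple dS aS).
by rewrite eq_sym (negPf da) !mul0r mulr0 subr0 leNgt db.
Qed.

Lemma srefl_perm a : a \in Simple ->
  perm_eq [seq s a b | b <- Pos & b != a] [seq b <- Pos | b != a].
Proof.
move=> aS; have sinj := can_inj (sreflK ipP a).
rewrite uniq_perm ?map_inj_uniq ?filter_uniq ?fset_uniq //.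
have sub x : x \in [seq b <- Pos | b != a] -> s a x \in [seq b <- Pos | b != a].
  rewrite !mem_filter => /andP[xa xP]; rewrite srefl_Pos // andbT.
  apply: contraNneq (Pos_opp (Simple_Pos aS)) => sx.
  have <- : s a (s a x) = - a by rewrite sx srefl_id.
  by rewrite sreflK.
move=> x; apply/mapP/idP => [[y yP ->] | xP]; first exact: sub.
by exists (s a x); rewrite ?sreflK // sub.
Qed.

Definition weyl_vector : E := 2^-1 *: \sum_(a <- Pos) a.

Lemma Pos_split a (F : E -> E) : a \in Pos ->
  \sum_(b <- Pos) F b = F a + \sum_(b <- Pos | b != a) F b.
Proof. by move=> aP; rewrite (bigD1_seq a) ?fset_uniq. Qed.

(** A simple reflection permutes the positive roots other than the simple root
    itself, so that the half sum takes the value 1 on every simple coroot. *)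
Lemma weyl_vectorE : weyl_vector = \sum_(a <- Simple) fund_weight a.
Proof.
apply: cart_inj => a aS; have a0 := Simple_neq0 aS.
transitivity (1 : R).
  rewrite /weyl_vector cartZ // (Pos_split _ (Simple_Pos aS)) cartD // cart_id //.
  set x := \sum_(b <- Pos | _) b.
  suff -> : c a x = 0 by field.
  have sx : s a x = x.
    rewrite /x linear_sum /= -[RHS]big_filter -(perm_big _ (srefl_perm aS)) /=.
    by rewrite big_map big_filter.
  apply/eqP; move/eqP: sx; rewrite sreflE // -subr_eq0 addrAC subrr add0r oppr_eq0.
  by rewrite scaler_eq0 (negPf a0) orbF.
rewrite cart_sum // (bigD1_seq a) ?fset_uniq //= fund_weightE // eqxx big_seq_cond big1 ?addr0 //.
by move=> b /andP[bS ba]; rewrite fund_weightE // eq_sym (negPf ba).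
Qed.

(** * The Weyl group *)

(** All reflections are allowed as generators; [weyl_word] reduces to the simple
    ones. *)
Inductive weyl : 'End(E) -> Prop :=
| weyl1 : weyl \1%VF
| weylM a w : a \in Phi -> weyl w -> weyl (s a \o w)%VF.

Definition wprod (ss : seq E) : 'End(E) := foldr (fun a w => s a \o w)%VF \1%VF ss.

Lemma wprod_cons a ss x : wprod (a :: ss) x = s a (wprod ss x).
Proof. by rewrite /= lfunE. Qed.

Lemma wprod0 x : wprod [::] x = x. Proof. by rewrite /= lfunE. Qed.

Lemma wprod_cat ss ss' x : wprod (ss ++ ss') x = wprod ss (wprod ss' x).
Proof.
by elim: ss => [|a ss IH]; rewrite ?wprod0 // cat_cons !wprod_cons IH.
Qed.

Lemma wprod_rcons ss a x : wprod (rcons ss a) x = wprod ss (s a x).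
Proof. by rewrite -cats1 wprod_cat wprod_cons wprod0. Qed.

Lemma wprod_revK ss : cancel (wprod ss) (wprod (rev ss)).
Proof.
elim: ss => [|a ss IH] x; first by rewrite !wprod0.
by rewrite rev_cons wprod_rcons wprod_cons sreflK // IH.
Qed.

Lemma wprodK ss : cancel (wprod (rev ss)) (wprod ss).
Proof. by move=> x; rewrite -{1}(revK ss) wprod_revK. Qed.

Lemma ip_wprod ss x y : ip (wprod ss x) (wprod ss y) = ip x y.
Proof.
by elim: ss => [|a ss IH]; rewrite ?wprod0 // !wprod_cons ip_srefl.
Qed.

Lemma srefl_wprod ss a x : s (wprod ss a) (wprod ss x) = wprod ss (s a x).
Proof.
by rewrite !sreflE // [in RHS]linearB [in RHS]linearZ /= /cart !ip_wprod.
Qed.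

Lemma wprod_Phi ss a : {subset ss <= Phi} -> a \in Phi -> wprod ss a \in Phi.
Proof.
elim: ss => [|b ss IH] sP aP; first by rewrite wprod0.
rewrite wprod_cons; apply: (rs_refl rsP); first by rewrite sP ?mem_head.
by apply: IH => // d dS; rewrite sP // in_cons dS orbT.
Qed.

Lemma sub_Simple_Phi (ss : seq E) : {subset ss <= Simple} -> {subset ss <= Phi}.
Proof. by move=> sS a /sS/Simple_Phi. Qed.

(** Reflecting in a simple root at an acute angle decreases the height. *)
Lemma Pos_conj b : b \in Pos ->
  exists ss a, [/\ {subset ss <= Simple}, a \in Simple & b = wprod ss a].
Proof.
move: b; apply: Pos_ev_ind => b bP IH.
have [bS | bS] := boolP (b \in Simple).
  by exists [::], b; split=> //; rewrite wprod0.
have [a [aS ab]] : exists a, a \in Simple /\ 0 < ip b a.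
  apply: contrapT => H.
  have b0 a : a \in Simple -> ip b a <= 0.
    by move=> aS; rewrite leNgt; apply/negP => ab; apply: H; exists a.
  have bPos a : a \in Pos -> ip b a <= 0.
    move: a; apply: Pos_ind => // a a' _ _ ba ba'.
    by rewrite (ipDr ipP) -[0]addr0 lerD.
  by have := Pos_neq0 bP; rewrite (ip_le0 ipP (bPos b bP)) eqxx.
have ba : b != a by apply: contraNneq bS => ->.
have sP := srefl_Pos aS bP ba.
have lt : ev (s a b) < ev b.
  rewrite sreflE // evB evZ gtrBl mulr_gt0 ?(Pos_ev (Simple_Pos aS)) //.
  by rewrite cart_gt0 // Simple_neq0.
have [ss [a' [ssS a'S sb]]] := IH _ sP lt.
exists (a :: ss), a'; split=> //; last by rewrite wprod_cons -sb sreflK.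
by move=> d; rewrite in_cons => /orP[/eqP -> | /ssS].
Qed.

(** The reflection in the image of a simple root is a conjugate of a simple
    reflection. *)
Lemma srefl_word a : a \in Phi ->
  exists2 ss, {subset ss <= Simple} & s a = wprod ss.
Proof.
suff H b : b \in Pos -> exists2 ss, {subset ss <= Simple} & s b = wprod ss.
  by move=> /Phi_Pos[/H // | /H[ss ssS]]; rewrite sreflN //; exists ss.
move=> /Pos_conj[ss [d [ssS dS ->]]]; exists (ss ++ d :: rev ss).
  move=> x; rewrite mem_cat in_cons mem_rev => /or3P[/ssS | /eqP -> | /ssS] //.
apply/lfunP => x; rewrite wprod_cat wprod_cons -srefl_wprod.
by rewrite wprodK.
Qed.

Lemma weyl_word w : weyl w -> exists2 ss, {subset ss <= Simple} & w = wprod ss.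
Proof.
elim=> [|a v aP _ [ss ssS ->]]; first by exists [::].
have [st stS ->] := srefl_word aP; exists (st ++ ss).
  by move=> x; rewrite mem_cat => /orP[/stS | /ssS].
by apply/lfunP => x; rewrite lfunE wprod_cat.
Qed.

Lemma weyl_wprod ss : {subset ss <= Simple} -> weyl (wprod ss).
Proof.
elim: ss => [|a ss IH] sS; first exact: weyl1.
apply: weylM; first by rewrite Simple_Phi // sS ?mem_head.
by apply: IH => x xs; rewrite sS // in_cons xs orbT.
Qed.

Lemma weyl_comp v w : weyl v -> weyl w -> weyl (v \o w)%VF.
Proof.
move=> + wW; elim=> [|a u aP _ IH]; first by rewrite comp_lfun1l.
by rewrite -comp_lfunA; apply: weylM.
Qed.

Lemma ip_weyl w x y : weyl w -> ip (w x) (w y) = ip x y.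
Proof. by move=> /weyl_word[ss _ ->]; rewrite ip_wprod. Qed.

Lemma weyl_Phi w a : weyl w -> a \in Phi -> w a \in Phi.
Proof. by move=> /weyl_word[ss /sub_Simple_Phi sS ->]; apply: wprod_Phi. Qed.

Lemma weylK w : weyl w -> cancel w (w^-1)%VF.
Proof.
move=> /weyl_word[ss _ ->] x; apply: lker0_lfunK.
by apply/lker0P; apply: can_inj (@wprod_revK ss).
Qed.

Lemma weylVK w : weyl w -> cancel (w^-1)%VF w.
Proof.
move=> wW x; have [ss _ wE] := weyl_word wW.
by rewrite -(wprodK ss x) -wE (weylK wW).
Qed.

Lemma weylV w : weyl w -> weyl (w^-1)%VF.
Proof.
move=> wW; have [ss ssS wE] := weyl_word wW.
suff -> : (w^-1 = wprod (rev ss))%VF.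
  by apply: weyl_wprod => x; rewrite mem_rev => /ssS.
by apply/lfunP => x; rewrite -{1}(wprodK ss x) -wE (weylK wW).
Qed.

(** The exchange property: the simple reflection at which the image of [a] turns
    negative cancels against the reflection in [a]. *)
Lemma wprod_exchange ss a : {subset ss <= Simple} -> a \in Simple ->
  wprod ss a \notin Pos ->
  exists st, [/\ {subset st <= Simple}, (size st < size ss)%N
               & wprod (rcons ss a) = wprod st].
Proof.
move=> + aS; elim: ss => [|b ss IH] sS; first by rewrite wprod0 Simple_Pos.
have bS : b \in Simple by rewrite sS ?mem_head.
have {}sS : {subset ss <= Simple} by move=> x xs; rewrite sS // in_cons xs orbT.
rewrite wprod_cons => bP; have [aP | aP] := boolP (wprod ss a \in Pos); last first.
  have [st [stS sz E1]] := IH sS aP; exists (b :: st); split=> //; last first.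
    by rewrite rcons_cons /= E1.
  by move=> x; rewrite in_cons => /orP[/eqP -> | /stS].
have ab : wprod ss a = b by apply: contraNeq bP => H; apply: srefl_Pos.
exists ss; split=> //; apply/lfunP => x.
by rewrite rcons_cons wprod_cons wprod_rcons -srefl_wprod ab sreflK.
Qed.

Definition dominant x := forall a, a \in Simple -> 0 <= c a x.

Lemma dominant_Pos x a : dominant x -> a \in Pos -> 0 <= ip x a.
Proof.
move=> xD; move: a; apply: Pos_ind => [a aS | a b _ _ xa xb].
  by rewrite -cart_ge0 ?Simple_neq0 // xD.
by rewrite (ipDr ipP) addr_ge0.
Qed.

(** By the exchange property a word can be shortened unless its last letter only
    lowers the image of a dominant vector. *)
Lemma weyl_dominant_le w x y : weyl w -> dominant x -> dominant y ->
  ip (w x) y <= ip x y.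
Proof.
move=> /weyl_word[ss sS ->{w}] xD yD.
elim: {ss}(size ss).+1 {-2}ss (ltnSn (size ss)) sS => // n IH ss.
case/lastP: ss => [|ss a] sz sS; first by rewrite wprod0.
have aS : a \in Simple by rewrite sS // mem_rcons mem_head.
have ssS : {subset ss <= Simple}.
  by move=> z zs; rewrite sS // mem_rcons in_cons zs orbT.
rewrite size_rcons ltnS in sz.
have [aP | aP] := boolP (wprod ss a \in Pos); last first.
  have [st [stS stz ->]] := wprod_exchange ssS aS aP.
  by apply: IH stS; apply: leq_trans stz _; apply: ltnW.
rewrite wprod_rcons sreflE // linearB linearZ /= (ipBl ipP) (ipZl ipP).
apply: le_trans (IH _ sz ssS); rewrite gerBl mulr_ge0 ?xD //.
by rewrite (ipC ipP) dominant_Pos.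
Qed.

(** A lower bound on the inner product of two vectors of the same norm bounds the
    norm of their difference. *)
Lemma weyl_dominant_eq w x : weyl w -> dominant x ->
  ip x x <= ip (w x) x -> w x = x.
Proof.
move=> wW xD wx; apply/eqP; rewrite -subr_eq0; apply/eqP/(ip_le0 ipP).
rewrite !(ipBl ipP, ipBr ipP) (ip_weyl _ _ wW) (ipC ipP x (w x)).
by rewrite subr_le0 lerBlDr -subr_ge0; lra.
Qed.

Lemma weyl_dominant_unique w x : weyl w -> dominant x -> dominant (w x) -> w x = x.
Proof.
move=> wW xD wxD; apply: weyl_dominant_eq => //.
by rewrite -{1}(ip_weyl x x wW) (ipC ipP (w x) x) weyl_dominant_le.
Qed.

(** In the expansion of x - w x = 0 along the fundamental weights, each term
    pairs nonnegatively with every dominant vector. *)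
Lemma weyl_fix_fund_weight w x a : weyl w -> dominant x -> w x = x ->
  a \in Simple -> 0 < c a x -> w (fund_weight a) = fund_weight a.
Proof.
move=> wW xD wx aS ca.
have fD b : b \in Simple -> dominant (fund_weight b).
  by move=> bS d dS; rewrite fund_weightE // ler0n.
apply: weyl_dominant_eq => //; first exact: fD.
have : \sum_(b <- Simple) c b x * 
    (ip (fund_weight b) (fund_weight a) - ip (w (fund_weight b)) (fund_weight a)) = 0.
  transitivity (ip (x - w x) (fund_weight a)); last by rewrite wx subrr (ip0l ipP).
  rewrite {2 3}(fund_weight_expand x) linear_sum (ipBl ipP) !(ip_suml ipP) -sumrB.
  by apply: eq_bigr => b _; rewrite linearZ /= !(ipZl ipP) mulrBr.
rewrite (bigD1_seq a) ?fset_uniq //= => H.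
rewrite -subr_le0 -(pmulr_rle0 _ ca) -H lerDl.
rewrite big_seq_cond sumr_ge0 // => b /andP[bS _].
by rewrite mulr_ge0 ?xD // subr_ge0 weyl_dominant_le //; apply: fD.
Qed.

(** Isometries are determined by the permutation which they induce on the spanning
    set of roots. *)
Lemma finite_weyl : finite_set [set w | weyl w].
Proof.
pose f (w : 'End(E)) := [ffun a : Phi => insub (w (val a)) : option Phi].
apply: (finite_set_injP (f := f)) => v w vW wW /ffunP fvw.
have vw a : a \in Phi -> v a = w a.
  move=> aP; have := fvw [` aP]%fset; rewrite !ffunE /=.
  by rewrite !insubT ?weyl_Phi // => ? ? [].
apply/lfunP => x; apply/eqP; rewrite -subr_eq0; apply/eqP/(rs_span rsP) => a aP.
have bP := weyl_Phi (weylV wW) aP.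
rewrite -(weylVK wW a) (ipBl ipP) ip_weyl // -vw // ip_weyl //.
by rewrite subrr.
Qed.

Definition W : {fset 'End(E)} := fset_set [set w | weyl w].

Lemma in_W w : (w \in W) = `[< weyl w >].
Proof. rewrite in_fset_set; last exact: finite_weyl.
by apply/idP/asboolP => [/set_mem | /mem_set]. Qed.

Lemma W_weyl w : w \in W -> weyl w. Proof. by rewrite in_W => /asboolP. Qed.
Lemma weyl_W w : weyl w -> w \in W. Proof. by rewrite in_W => /asboolP. Qed.

(** A vector of the orbit at which [ev] is maximal is dominant, since reflecting it
    in a simple root does not increase [ev]. *)
Lemma dominant_conj x : exists2 w, weyl w & dominant (w x).
Proof.
pose w0 : W := [` weyl_W weyl1]%fset.
case: (@arg_maxP _ _ _ w0 xpredT (fun w : W => ev (val w x)) isT) => w _ wM.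
have wW := W_weyl (valP w); exists (val w) => // a aS.
have saW : weyl (s a \o val w)%VF by apply: weylM; rewrite ?Simple_Phi.
have := wM [` weyl_W saW]%fset isT; rewrite /= lfunE /= sreflE // evB evZ.
by rewrite gerBl pmulr_lge0 // Pos_ev // Simple_Pos.
Qed.

Lemma W_perm_l u : weyl u -> perm_eq [seq (u \o w)%VF | w <- W] W.
Proof.
move=> uW; have uI : injective (fun w : 'End(E) => u \o w)%VF.
  move=> v w /lfunP vw; apply/lfunP => x; apply: (can_inj (weylK uW)).
  by have := vw x; rewrite !lfunE.
rewrite uniq_perm ?map_inj_uniq ?fset_uniq // => w; apply/mapP/idP.
  by move=> [v vW ->]; apply/weyl_W/weyl_comp => //; apply: W_weyl.
move=> wW; exists (u^-1 \o w)%VF.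
  by apply/weyl_W/weyl_comp; [apply: weylV | apply: W_weyl].
by apply/lfunP => x; do 2 rewrite lfunE /=; rewrite (weylVK uW).
Qed.

Lemma W_perm_r u : weyl u -> perm_eq [seq (w \o u)%VF | w <- W] W.
Proof.
move=> uW; have uI : injective (fun w : 'End(E) => w \o u)%VF.
  move=> v w /lfunP vw; apply/lfunP => x; rewrite -(weylVK uW x).
  by have := vw (u^-1%VF x); rewrite !lfunE.
rewrite uniq_perm ?map_inj_uniq ?fset_uniq // => w; apply/mapP/idP.
  by move=> [v vW ->]; apply/weyl_W/weyl_comp => //; apply: W_weyl.
move=> wW; exists (w \o u^-1)%VF.
  by apply/weyl_W/weyl_comp; [apply: W_weyl | apply: weylV].
by apply/lfunP => x; do 2 rewrite lfunE /=; rewrite (weylK uW).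
Qed.

(** Determinants of Weyl group elements are computed by products of odd functions
    over the positive roots: a simple reflection changes the sign of one factor
    and permutes the others. *)
Lemma prod_odd_weyl (A : comPzRingType) (iota : {rmorphism R -> A}) (phi : E -> A) w :
  (forall x, phi (- x) = - phi x) -> weyl w ->
  \prod_(a <- Pos) phi (w a) = iota (endo_det w) * \prod_(a <- Pos) phi a.
Proof.
move=> phiN /weyl_word[ss sS ->{w}]; elim/last_ind: ss sS => [|ss a IH] sS.
  by rewrite endo_det1 rmorph1 mul1r; apply: eq_bigr => a _; rewrite wprod0.
have aS : a \in Simple by rewrite sS // mem_rcons mem_head.
have -> : wprod (rcons ss a) = (wprod ss \o s a)%VF.
  by apply/lfunP => x; rewrite wprod_rcons lfunE.
rewrite endo_detM rmorphM mulrAC -IH; last first.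
  by move=> z zs; rewrite sS // mem_rcons in_cons zs orbT.
rewrite endo_det_srefl ?Simple_neq0 // rmorphN1 mulrN1.
rewrite !(bigD1_seq a (Simple_Pos aS)) ?fset_uniq //=.
rewrite lfunE /= srefl_id // linearN /= phiN -mulNr; congr (_ * _).
rewrite -[RHS]big_filter -(perm_big _ (srefl_perm aS)) /= big_map big_filter.
by apply: eq_bigr => b _; rewrite lfunE.
Qed.

(** * Summing over the chambers of the weight lattice *)

Definition indic (b : bool) : int := b%:R.

Definition in_lattice x := all (fun a => c a x \is a Num.int) Simple.
Definition in_cone x := all (fun a => c a x \is a Num.nat) Simple.

Lemma in_coneE x : in_lattice x -> in_cone x <-> dominant x.
Proof.
move=> /allP xL; split=> [/allP xC a aS | xD]; first by rewrite natr_ge0 // xC.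
by apply/allP => a aS; rewrite natrEint xL // xD.
Qed.

Lemma in_cone_lattice x : in_cone x -> in_lattice x.
Proof. by move/allP => xC; apply/allP => a /xC; rewrite natrEint => /andP[]. Qed.

Lemma in_lattice_weyl w x : weyl w -> in_lattice (w x) = in_lattice x.
Proof.
move=> /weyl_word[ss sS ->{w}].
have sP d y : d \in Simple -> in_lattice y -> in_lattice (s d y).
  move=> dS /allP yL; apply/allP => a aS; rewrite sreflE // cartB // cartZ //.
  apply: rpredB; first exact: yL.
  by apply: rpredM; [exact: yL | apply: (rs_int rsP); apply: Simple_Phi].
elim: ss sS => [|b ss IH] sS; first by rewrite wprod0.
have bS : b \in Simple by rewrite sS ?mem_head.
rewrite wprod_cons -IH => [|z zs]; last by rewrite sS // in_cons zs orbT.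
by apply/idP/idP => /(sP _ _ bS) //; rewrite sreflK.
Qed.

Lemma in_lattice_fund_weight a : a \in Simple -> in_lattice (fund_weight a).
Proof. by move=> aS; apply/allP => b bS; rewrite fund_weightE // rpred_nat. Qed.

(** The closed chambers containing a lattice point correspond to a coset of its
    stabiliser in the Weyl group. *)
Lemma chambers_at x :
  \sum_(w <- W) indic (in_cone ((w^-1)%VF x)) =
  \sum_(u <- W) indic (in_lattice x && (u x == x)).
Proof.
have [xL | xL] /= := boolP (in_lattice x); last first.
  rewrite [RHS]big1 // big_seq big1 // => w /W_weyl wW.
  suff /negPf-> : ~~ in_cone (w^-1%VF x) by [].
  by apply: contra xL => /in_cone_lattice; rewrite in_lattice_weyl //; apply: weylV.
have [v vW vD] := dominant_conj x.
rewrite -[X in _ = X](perm_big _ (W_perm_r vW)) big_map big_seq [RHS]big_seq.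
apply: eq_bigr => w /W_weyl wW; congr (indic _).
have wxL : in_lattice (w^-1%VF x) by rewrite in_lattice_weyl //; apply: weylV.
rewrite lfunE /=; apply/idP/eqP => [/(in_coneE wxL) wD | wx].
  rewrite -[RHS](weylVK wW); congr (w _).
  have uW := weyl_comp (weylV wW) (weylV vW).
  have := weyl_dominant_unique uW vD; rewrite lfunE /= (weylK vW).
  by move=> /(_ wD) ->.
by apply/(in_coneE wxL); rewrite -[X in w^-1%VF X]wx (weylK wW).
Qed.

Lemma nat_fdiff (r : R) :
  indic (r \is a Num.nat) - indic (r - 1 \is a Num.nat) = indic (r == 0).
Proof.
have [/natrP[[|k] ->] | rN] := boolP (r \is a Num.nat).
- rewrite eqxx sub0r; case: natrP => [[k] kE | _]; last by rewrite subr0.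
  by have := ler0n R k; rewrite -kE oppr_ge0 ler10.
- by rewrite -natr1 addrK natr_nat natr1 pnatr_eq0 subrr.
have /negPf-> : r - 1 \isn't a Num.nat.
  by apply: contra rN => rN; rewrite -(subrK 1 r); apply: rpredD => //; exact: rpred1.
by rewrite subr0; case: eqP rN => // ->; rewrite rpred0.
Qed.

(** A chamber is a simplicial unimodular cone, whose generating function is the
    product of the inverses of 1 - e^v over its generators v. *)
Lemma fdiff_cone w z : weyl w ->
  fdiff [seq w (fund_weight a) | a <- Simple]
    (fun y => indic (in_cone (w^-1%VF (z - y)))) = indic (z == 0).
Proof.
move=> wW; pose k a y : R := c a (w^-1%VF y).
have kB a b x y : a \in Simple -> b \in Simple ->
    k a (x - (y + w (fund_weight b))) = k a (x - y) - (a == b)%:R.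
  by move=> aS bS; rewrite /k opprD addrA linearB /= cartB // (weylK wW) fund_weightE.
pose N (r : R) := indic (r \is a Num.nat); pose Z (r : R) := indic (r == 0).
have allE (f : R -> bool) y (L : seq E) :
    indic (all (fun a => f (k a y)) L) = \prod_(a <- L) indic (f (k a y)).
  by rewrite /indic; elim: L => [|a L IH]; rewrite ?big_nil // big_cons /= -IH;
    case: (f _);
    rewrite ?mul1r ?mul0r.
have dprod (L : seq E) : uniq L -> {subset L <= Simple} ->
    fdiff [seq w (fund_weight a) | a <- L] (fun y => \prod_(a <- L) N (k a (z - y))) =
    \prod_(a <- L) Z (k a z).
  elim: L => [|b L IH] /=; first by rewrite !big_nil.
  move=> /andP[bL uL] sL; have bS : b \in Simple by rewrite sL ?mem_head.
  have {}sL : {subset L <= Simple} by move=> a aL; rewrite sL // in_cons aL orbT.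
  transitivity (fdiff [seq w (fund_weight a) | a <- L]
      (fun y => Z (k b (z - y)) * \prod_(a <- L) N (k a (z - y)))).
    apply: eq_fdiff => y; rewrite !big_cons.
    rewrite [X in _ - _ * X](_ : _ = \prod_(a <- L) N (k a (z - y))); last first.
      rewrite big_seq [RHS]big_seq; apply: eq_bigr => a aL.
      rewrite (kB _ _ _ _ (sL _ aL) bS); have [ab|ab] := eqVneq a b.
        by move: bL; rewrite -ab aL.
      by rewrite /= subr0.
    by rewrite -mulrBl kB // eqxx /N nat_fdiff.
  rewrite fdiff_mul_period => [|x v /mapP[a aL ->]].
    by rewrite subr0 IH // big_cons.
  rewrite (kB _ _ _ _ bS (sL _ aL)); have [ba|ba] := eqVneq b a.
    by move: bL; rewrite ba aL.
  by rewrite /= subr0.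
transitivity (\prod_(a <- Simple) Z (k a z)); last first.
  rewrite -(allE (fun r => r == 0)); congr (indic _).
  apply/allP/eqP => [k0 | -> a _]; last by rewrite /k linear0 cart0.
  rewrite -(weylVK wW z) (_ : w^-1%VF z = 0) ?linear0 //.
  by apply: cart_inj => a /k0/eqP kz; rewrite (cart0 ipP).
rewrite -dprod ?fset_uniq //; apply: eq_fdiff => y.
by rewrite -(allE (fun r => r \is a Num.nat)).
Qed.

(** Generators common to several chambers are repeated in [all_gens], so that the
    generators of a chamber split off from it as a sublist. *)
Definition chamber_gens (w : 'End(E)) := [seq w (fund_weight a) | a <- Simple].
Definition all_gens := flatten [seq chamber_gens w | w <- W].

(** By conjugation the fixed point may be taken dominant; then every fundamental
    weight with a positive coefficient in it is fixed as well. *)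
Lemma fixed_gen u x : weyl u -> in_lattice x -> x != 0 -> u x = x ->
  has (fun v => u v == v) all_gens.
Proof.
move=> uW xL x0 ux; have [w wW wD] := dominant_conj x.
have [a [aS ca]] : exists a, a \in Simple /\ 0 < c a (w x).
  apply: contrapT => H; case/eqP: x0.
  rewrite -(weylK wW x) (_ : w x = 0) ?linear0 //; apply: cart_inj => a aS.
  rewrite (cart0 ipP); apply: le_anti; rewrite (wD a aS) andbT leNgt.
  by apply/negP => ca; apply: H; exists a.
have vW := weyl_comp wW (weyl_comp uW (weylV wW)).
have vwx : (w \o (u \o w^-1))%VF (w x) = w x.
  by do 2 rewrite lfunE /=; rewrite (weylK wW) ux.
have := weyl_fix_fund_weight vW wD vwx aS ca; do 2 rewrite lfunE /=; move=> va.
apply/hasP; exists ((w^-1)%VF (fund_weight a)).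
  apply/flattenP; exists (chamber_gens w^-1%VF); apply/mapP; last by exists a.
  by exists (w^-1)%VF => //; apply/weyl_W/weylV.
by rewrite -{2}va (weylK wW).
Qed.

Lemma all_gens_lattice v : v \in all_gens -> in_lattice v.
Proof.
move=> /flattenP[_ /mapP[w wW ->] /mapP[a aS ->]].
by rewrite in_lattice_weyl ?in_lattice_fund_weight //; apply: W_weyl.
Qed.

Lemma in_latticeD x y : in_lattice y -> in_lattice (x + y) = in_lattice x.
Proof.
move=> /allP yL; apply: eq_in_all => a aS; rewrite cartD //.
by apply: rpredDr; apply: yL.
Qed.

(** A generator fixed by [u] is a period of the indicator function of the lattice
    points fixed by [u]; without such a generator only 0 is fixed. *)
Lemma fdiff_fixed u z : weyl u ->
  fdiff all_gens (fun y => indic (in_lattice (z - y) && (u (z - y) == z - y))) =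
  indic (~~ has (fun v => u v == v) all_gens) * fdiff all_gens (fun y => indic (y == z)).
Proof.
move=> uW; have [/hasP[v vG /eqP uv] | noG] := boolP (has _ all_gens).
  rewrite mul0r; apply: (fdiff_period vG) => x; congr (indic _).
  have vL := all_gens_lattice vG.
  have -> : z - x = z - (x + v) + v by rewrite opprD addrA subrK.
  by rewrite [in RHS]in_latticeD // [in RHS](linearD u) /= uv (inj_eq (addIr v)).
rewrite mul1r; apply: eq_fdiff => y; congr (indic _).
rewrite -[y == z]eq_sym -(subr_eq0 z y).
have [-> | zy] := eqVneq (z - y) 0.
  rewrite linear0 eqxx andbT; apply/allP => a _.
  by rewrite (cart0 ipP) rpred0.
apply: contraNF noG => /andP[zyL /eqP uzy].
exact: fixed_gen uW zyL zy uzy.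
Qed.

(** The elements of the Weyl group fixing no chamber generator are those without
    nonzero fixed vectors. *)
Definition fixfree_card : nat :=
  count (fun u : 'End(E) => ~~ has (fun v => u v == v) all_gens) W.

Definition other_gens (w : 'End(E)) := flatten [seq chamber_gens v | v <- rem w W].

Lemma perm_all_gens w : w \in W ->
  perm_eq all_gens (other_gens w ++ chamber_gens w).
Proof.
move=> wW; rewrite perm_sym perm_catC perm_sym.
by apply: (perm_flatten (perm_map _ (perm_to_rem wW)) : _ ).
Qed.

(** Both sides are compared coefficientwise, i.e. on indicator functions of
    points; the sum over chambers turns into a sum over fixed lattices. *)
Lemma chamber_sum_group_ring (V : zmodType) (g : E -> V) :
  \sum_(w <- W) fdiff (other_gens w) g = fdiff all_gens g *+ fixfree_card.
Proof.
apply: subr0_eq; move: V g; apply: group_ring_elt_eq0.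
  apply: group_ring_eltB.
    by apply: group_ring_elt_sum => w; apply: fdiff_group_ring.
  have -> : (fun V g => @fdiff E V all_gens g *+ fixfree_card) =
     (fun V g => \sum_(i <- iota 0 fixfree_card) @fdiff E V all_gens g).
    apply: functional_extensionality_dep => V; apply: funext => g.
    by rewrite big_const_seq count_predT size_iota iter_addr_0.
  by apply: group_ring_elt_sum => i; apply: fdiff_group_ring.
move=> z; apply/eqP; rewrite subr_eq0; apply/eqP.
transitivity (\sum_(w <- W)
    fdiff all_gens (fun y => indic (in_cone ((w^-1)%VF (z - y))))).
  rewrite big_seq [RHS]big_seq; apply: eq_bigr => w wW.
  rewrite (perm_fdiff _ (perm_all_gens wW)) fdiff_cat; apply: eq_fdiff => y.
  under eq_fdiff => x do rewrite opprD addrA.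
  by rewrite (fdiff_cone (z - y) (W_weyl wW)) subr_eq0 eq_sym.
rewrite -fdiff_sum; under eq_fdiff => y do rewrite chambers_at.
rewrite fdiff_sum big_seq.
transitivity (\sum_(u <- W) indic (~~ has (fun v => u v == v) all_gens) *
                 fdiff all_gens (fun y => indic (y == z))).
  by rewrite [RHS]big_seq; apply: eq_bigr => u /W_weyl uW; rewrite fdiff_fixed.
rewrite -big_distrl /= -mulr_natl; congr (_ * _).
rewrite /fixfree_card; elim: (W : seq _) => [|u r IH]; first by rewrite big_nil.
by rewrite big_cons /= IH natrD.
Qed.

(** For a character of the weight lattice this is an identity between finite
    products, which can be divided by all of them. *)
Theorem chamber_sum (A : comUnitRingType) (t : E -> A) :
  t 0 = 1 -> (forall x y, t (x + y) = t x * t y) ->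
  (forall w a, weyl w -> a \in Simple -> 1 - t (w (fund_weight a)) \is a GRing.unit) ->
  \sum_(w <- W) (\prod_(a <- Simple) (1 - t (w (fund_weight a))))^-1 = fixfree_card%:R.
Proof.
move=> t0 tD tU.
pose p w := \prod_(a <- Simple) (1 - t (w (fund_weight a))).
have pU w : w \in W -> p w \is a GRing.unit.
  by move=> /W_weyl wW; rewrite /p big_seq rpred_prod // => a aS; apply: tU.
have fdiffE S : fdiff S t = \prod_(v <- S) (1 - t v).
  have := fdiff_character S 1 tD; rewrite t0 !mul1r => <-.
  by apply: eq_fdiff => x; rewrite mul1r.
have flatE r : \prod_(v <- flatten [seq chamber_gens v | v <- r]) (1 - t v) =
               \prod_(w <- r) p w.
  elim: r => [|w r IH]; first by rewrite !big_nil.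
  by rewrite /= big_cat big_cons IH /= big_map.
have := chamber_sum_group_ring t; rewrite fdiffE flatE => H.
have PU : \prod_(w <- W) p w \is a GRing.unit.
  by rewrite big_seq rpred_prod.
apply: (mulIr PU); rewrite mulr_natl -H big_distrl /= big_seq [RHS]big_seq.
apply: eq_bigr => w wW; rewrite fdiffE flatE (perm_big _ (perm_to_rem wW)) big_cons.
by rewrite mulKr ?pU.
Qed.

(** * The double sum over the Weyl group *)

Lemma endo_det_weyl w : weyl w -> endo_det w * endo_det w = 1.
Proof.
move=> /weyl_word[ss sS ->{w}]; elim: ss sS => [|a ss IH] sS.
  by rewrite /= endo_det1 mulr1.
rewrite /= endo_detM endo_det_srefl //; last first.
  by rewrite Simple_neq0 // sS ?mem_head.
by rewrite mulrACA IH ?mulr1 ?mulrNN ?mulr1 // => z zs; rewrite sS // in_cons zs orbT.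
Qed.

Lemma Simple_nonempty : (exists a, a \in Phi) -> exists a, a \in Simple.
Proof.
case=> a aP; apply: contrapT => noS; have := Phi_neq0 aP.
rewrite (Simple_span (x := a)) ?eqxx // => b bS.
by case: noS; exists b.
Qed.

Lemma sum_endo_det : (exists a, a \in Phi) -> \sum_(w <- W) endo_det w = 0.
Proof.
move=> /Simple_nonempty[a aS].
have sW : weyl (s a) by rewrite -[s a]comp_lfun1r; apply: weylM (Simple_Phi aS) weyl1.
suff : \sum_(w <- W) endo_det w = - \sum_(w <- W) endo_det w by lra.
rewrite -{1}(perm_big _ (W_perm_l sW)) big_map -sumrN; apply: eq_bigr => w _.
by rewrite endo_detM endo_det_srefl ?Simple_neq0 // mulN1r.
Qed.

Definition fund : {fset E} := [fset fund_weight a | a in Simple]%fset.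

Lemma big_fund (V : Type) (idx : V) (op : Monoid.com_law idx) (F : E -> V) :
  \big[op/idx]_(l <- fund) F l = \big[op/idx]_(a <- Simple) F (fund_weight a).
Proof. by apply: big_imfset => a b /= aS bS; apply: fund_weight_inj. Qed.

Section DoubleSum.
Variables (A : comUnitRingType) (iota : {rmorphism R -> A}).

Section OneCharacter.
Variable z : E -> A.
Hypotheses (z0 : z 0 = 1) (zD : forall x y, z (x + y) = z x * z y).

Lemma charN x : z x * z (- x) = 1.
Proof. by rewrite -zD subrr z0. Qed.

Lemma char_unit x : z x \is a GRing.unit.
Proof. by apply/unitrP; exists (z (- x)); rewrite charN mulrC charN. Qed.

Lemma char_sum I (r : seq I) F : z (\sum_(i <- r) F i) = \prod_(i <- r) z (F i).
Proof. exact: (big_morph z zD z0). Qed.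

Definition weyl_denom := z weyl_vector * \prod_(a <- Pos) (1 - z (- a)).

(** With half roots the denominator is the product over the positive roots of the
    odd function x |-> z^(x/2) - z^(-x/2). *)
Lemma weyl_denomE w : weyl w ->
  z (w weyl_vector) * \prod_(a <- Pos) (1 - z (- w a)) = iota (endo_det w) * weyl_denom.
Proof.
pose phi x := z (2^-1 *: x) - z (2^-1 *: - x).
have phiN x : phi (- x) = - phi x by rewrite /phi opprK opprB.
have phiE (v : 'End(E)) :
    z (v weyl_vector) * \prod_(a <- Pos) (1 - z (- v a)) = \prod_(a <- Pos) phi (v a).
  rewrite /weyl_vector scaler_sumr linear_sum char_sum -big_split.
  apply: eq_bigr => a _; rewrite /= linearZ /= mulrBr mulr1 -zD; congr (_ - z _).
  rewrite scalerN -[X in _ - X](scale1r (v a)) -scalerBl -scaleNr.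
  by congr (_ *: _); field.
move=> wW; rewrite phiE (prod_odd_weyl iota phiN wW); congr (_ * _).
transitivity (\prod_(a <- Pos) phi (\1%VF a)).
  by apply: eq_bigr => a _; rewrite id_lfunE.
by rewrite -phiE id_lfunE; congr (_ * _); apply: eq_bigr => a _; rewrite id_lfunE.
Qed.

End OneCharacter.

Variables z z1 : E -> A.
Hypotheses (z0 : z 0 = 1) (zD : forall x y, z (x + y) = z x * z y).
Hypotheses (z10 : z1 0 = 1) (z1D : forall x y, z1 (x + y) = z1 x * z1 y).
Hypothesis zU : forall a, a \in Pos -> 1 - z (- a) \is a GRing.unit.
Hypothesis z1U : forall a, a \in Pos -> 1 - z1 (- a) \is a GRing.unit.
Hypothesis zz1U : forall w v a, weyl w -> weyl v -> a \in Simple ->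
  1 - z (- w (fund_weight a)) * z1 (- v (fund_weight a)) \is a GRing.unit.

Let Q (w v : 'End(E)) := \prod_(l <- fund) (1 - z (- w l) * z1 (- v l)).

Let QU w v : weyl w -> weyl v -> Q w v \is a GRing.unit.
Proof.
move=> wW vW; rewrite /Q big_fund big_seq rpred_prod // => a aS.
exact: zz1U.
Qed.

Lemma fund_factors (w v : 'End(E)) :
  \prod_(l <- fund) (1 - z (w l) * z1 (v l)) =
  (-1) ^+ size Simple * (z (w weyl_vector) * z1 (v weyl_vector)) * Q w v.
Proof.
have -> : weyl_vector = \sum_(l <- fund) l by rewrite big_fund weyl_vectorE.
rewrite !linear_sum !char_sum // /Q !big_fund -!big_split.
have -> : (-1) ^+ size Simple = \prod_(a <- Simple) (-1) :> A.
  by rewrite big_const_seq count_predT iter_mulr_1.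
rewrite -!big_split; apply: eq_bigr => a _ /=.
have e1 := charN z0 zD (w (fund_weight a)); have e2 := charN z10 z1D (v (fund_weight a)).
rewrite mulrBr mulr1 mulN1r.
by rewrite mulNr mulrACA e1 e2 mulr1 opprK addrC.
Qed.

Let sgn (w v : 'End(E)) := (-1) ^+ size Simple * endo_det w * endo_det v.

(** Termwise comparison of the two double sums: the two Weyl denominators and the
    product over the fundamental weights contribute the signs. *)
Lemma weyl_terms w v : weyl w -> weyl v ->
  (\prod_(a <- Pos) (1 - z (- w a)) * \prod_(l <- fund) (1 - z (w l) * z1 (v l)) *
   \prod_(a <- Pos) (1 - z1 (- v a)))^-1 =
  (weyl_denom z * weyl_denom z1)^-1 * (iota (sgn w v) / Q w v).
Proof.
move=> wW vW.
have -> : \prod_(a <- Pos) (1 - z (- w a)) * \prod_(l <- fund) (1 - z (w l) * z1 (v l)) *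
   \prod_(a <- Pos) (1 - z1 (- v a)) =
   iota (sgn w v) * Q w v * (weyl_denom z * weyl_denom z1).
  rewrite fund_factors /sgn !rmorphM rmorph_sign.
  have := weyl_denomE z0 zD wW; have := weyl_denomE z10 z1D vW.
  set p := \prod_(a <- Pos) (1 - z (- w a)).
  set p1 := \prod_(a <- Pos) (1 - z1 (- v a)).
  move: ((-1) ^+ _) (z _) (z1 _) p p1 (Q w v) => m b b1 p p1 q e1 e.
  transitivity (m * q * (b * p) * (b1 * p1)); first by ring.
  by rewrite e e1; ring.
have sgn2 : iota (sgn w v) * iota (sgn w v) = 1.
  rewrite -rmorphM /sgn mulrACA [X in X * _]mulrACA -exprMn mulrNN mulr1 expr1n mul1r.
  by rewrite !endo_det_weyl // mulr1 rmorph1.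
have sgnU : iota (sgn w v) \is a GRing.unit by apply/unitrP; exists (iota (sgn w v)).
have sgnV : (iota (sgn w v))^-1 = iota (sgn w v).
  by apply: (mulIr sgnU); rewrite mulVr // sgn2.
have dU (c1 : E -> A) : c1 0 = 1 -> (forall x y, c1 (x + y) = c1 x * c1 y) ->
    (forall a, a \in Pos -> 1 - c1 (- a) \is a GRing.unit) ->
    weyl_denom c1 \is a GRing.unit.
  move=> c0 cD cU; rewrite unitrM char_unit //= big_seq rpred_prod //.
have DU : weyl_denom z * weyl_denom z1 \is a GRing.unit by rewrite unitrM !dU.
have SQ : iota (sgn w v) * Q w v \is a GRing.unit by rewrite unitrM sgnU QU.
by rewrite (invrM SQ DU) (invrM sgnU (QU wW vW)) sgnV [_^-1 * iota _]mulrC.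
Qed.

(** Fixing u = v w^-1, the inner sum is a sum over the chambers for the character
    x |-> z^(-x) z1^(-u x), hence a constant independent of u. *)
Lemma alternating_sum0 : (exists a, a \in Phi) ->
  \sum_(w <- W) \sum_(v <- W) iota (sgn w v) / Q w v = 0.
Proof.
move=> Phi_ne.
transitivity (\sum_(w <- W) \sum_(u <- W)
    iota ((-1) ^+ size Simple * endo_det u) / Q w (u \o w)%VF).
  rewrite big_seq [RHS]big_seq; apply: eq_bigr => w /W_weyl wW.
  rewrite -(perm_big _ (W_perm_r wW)) big_map; apply: eq_bigr => u _.
  congr (iota _ / _); rewrite /sgn endo_detM -!mulrA; congr (_ * _).
  by rewrite mulrCA endo_det_weyl // mulr1.
rewrite exchange_big /=.
transitivity (\sum_(u <- W) iota ((-1) ^+ size Simple * endo_det u) * fixfree_card%:R).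
  rewrite big_seq [RHS]big_seq; apply: eq_bigr => u /W_weyl uW.
  rewrite -mulr_sumr; congr (_ * _).
  pose t x := z (- x) * z1 (- u x).
  rewrite -(@chamber_sum _ t).
  - rewrite /Q; apply: eq_bigr => w _; rewrite big_fund; congr (_^-1).
    by apply: eq_bigr => a _; rewrite /t lfunE.
  - by rewrite /t (linear0 u) !oppr0 z0 z10 mulr1.
  - by move=> x y; rewrite /t (linearD u) !opprD zD z1D mulrACA.
  move=> w a wW aS; rewrite /t.
  by have := zz1U wW (weyl_comp uW wW) aS; rewrite lfunE.
rewrite -mulr_suml -rmorph_sum -mulr_sumr sum_endo_det // mulr0 rmorph0.
by rewrite mul0r.
Qed.

Theorem weyl_double_sum : (exists a, a \in Phi) ->
  (z weyl_vector * z1 weyl_vector *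
     \prod_(a <- Pos) ((1 - z (- a)) * (1 - z1 (- a))))^-1 *
  (\sum_(w <- W) \sum_(v <- W)
     (iota ((-1) ^+ size Simple * endo_det w * endo_det v) /
      \prod_(l <- fund) (1 - z (- w l) * z1 (- v l))))
  = \sum_(w <- W) \sum_(v <- W)
      (\prod_(a <- Pos) (1 - z (- w a)) *
       \prod_(l <- fund) (1 - z (w l) * z1 (v l)) *
       \prod_(a <- Pos) (1 - z1 (- v a)))^-1
  /\
  \sum_(w <- W) \sum_(v <- W)
      (\prod_(a <- Pos) (1 - z (- w a)) *
       \prod_(l <- fund) (1 - z (w l) * z1 (v l)) *
       \prod_(a <- Pos) (1 - z1 (- v a)))^-1 = 0.
Proof.
move=> Phi_ne.
have dE : \sum_(w <- W) \sum_(v <- W)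
      (\prod_(a <- Pos) (1 - z (- w a)) *
       \prod_(l <- fund) (1 - z (w l) * z1 (v l)) *
       \prod_(a <- Pos) (1 - z1 (- v a)))^-1 =
    (weyl_denom z * weyl_denom z1)^-1 *
      \sum_(w <- W) \sum_(v <- W) iota (sgn w v) / Q w v.
  rewrite mulr_sumr big_seq [RHS]big_seq; apply: eq_bigr => w /W_weyl wW.
  rewrite mulr_sumr big_seq [RHS]big_seq; apply: eq_bigr => v /W_weyl vW.
  exact: weyl_terms.
rewrite dE; split; last by rewrite alternating_sum0 // mulr0.
by rewrite big_split /weyl_denom mulrACA.
Qed.

End DoubleSum.

End RootSystem.

(** * Commuting symmetric operators *)

Lemma finite_poly_roots (F : idomainType) (p : {poly F}) :
  p != 0 -> finite_set [set x | root p x].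
Proof.
move=> p0; apply: contrapT => inf.
have [X XP sX] := infinite_set_fset (size p) inf.
have := max_poly_roots p0 (rs := X); rewrite fset_uniq => H.
suff /H : all (root p) X by move=> /(_ isT); rewrite ltnNge sX.
by apply/allP => x /XP.
Qed.

Lemma finite_eigenvalues (F : fieldType) (V : vectType F) (f : 'End(V)) :
  finite_set [set c | exists2 v, v != 0 & f v = c *: v].
Proof.
have eB := vbasisP {:V}; set e := vbasis {:V} in eB.
pose M := passmx.mxof e e f.
apply: sub_finite_set (finite_poly_roots (monic_neq0 (char_poly_monic M))).
move=> c [v v0 fv] /=; rewrite -eigenvalue_root_char; apply/eigenvalueP.
exists (passmx.rVof e v); last by rewrite passmx.rVof_eq0.
by rewrite -passmx.rVof_app // fv; apply/rowP => i; rewrite !mxE linearZ.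
Qed.

Section SymmetricOperators.
Variables (R : realType) (V : vectType R) (B : V -> V -> R).
Hypothesis BP : inner_product B.

Definition ip_symmetric (f : 'End(V)) := forall x y, B (f x) y = B x (f y).

(** A complex eigenvalue a + b i with eigenvector X + i Y satisfies
    b (B X X + B Y Y) = 0. *)
Lemma symmetric_eigenvector (f : 'End(V)) (U : {vspace V}) :
  ip_symmetric f -> U != 0%VS -> (f @: U <= U)%VS ->
  exists v c, [/\ v \in U, v != 0 & f v = c *: v].
Proof.
move=> fS U0 fU; set n := \dim U.
have n0 : (0 < n)%N by rewrite lt0n dimv_eq0.
pose e := vbasis U; have eB : basis_of U e := vbasisP U.
pose M := \matrix_(i < n, j < n) coord e j (f e`_i).
pose vec (r : 'rV[R]_n) := \sum_i r 0 i *: e`_i.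
have eU (i : 'I_n) : e`_i \in U by rewrite vbasis_mem ?mem_nth ?size_tuple.
have fvec r : f (vec r) = vec (r *m M).
  rewrite /vec linear_sum /=.
  transitivity (\sum_(i < n) \sum_(j < n) (r 0 i * M i j) *: e`_j).
    apply: eq_bigr => i _; rewrite linearZ /=.
    have fe : f e`_i \in U by apply: (subvP fU); apply: memv_img.
    rewrite {1}(coord_vbasis fe) scaler_sumr; apply: eq_bigr => j _.
    by rewrite scalerA mxE.
  rewrite exchange_big; apply: eq_bigr => j _.
  by rewrite -scaler_suml mxE.
have vecU r : vec r \in U by rewrite rpred_sum // => i _; apply: rpredZ.
have vec0 r : (vec r == 0) = (r == 0).
  apply/eqP/eqP => [r0 | ->]; last by rewrite /vec big1 // => i _; rewrite mxE scale0r.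
  apply/rowP => i; rewrite mxE; have /freeP := basis_free eB; apply.
  by rewrite -[RHS]r0; apply: eq_bigr => j _.
have [c /eigenvalueP[w wM w0]] := eigenvalue_closed (map_mx (real_complex R) M) n0.
pose a := complex.Re c; pose b := complex.Im c.
pose X := \row_i complex.Re (w 0 i); pose Y := \row_i complex.Im (w 0 i).
have ReZ (z : R[i]) r : complex.Re (z * r%:C) = complex.Re z * r.
  by case: z => p q /=; rewrite mulr0 subr0.
have ImZ (z : R[i]) r : complex.Im (z * r%:C) = complex.Im z * r.
  by case: z => p q /=; rewrite mulr0 add0r mulrC.
have wj j : \sum_i w 0 i * (M i j)%:C = c * w 0 j.
  have /rowP/(_ j) := wM; rewrite !mxE => <-; apply: eq_bigr => i _.
  by rewrite [map_mx _ _ _ _]mxE.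
have XM : X *m M = a *: X - b *: Y.
  apply/rowP => j; rewrite !mxE.
  have /(congr1 (@complex.Re R)) := wj j; rewrite raddf_sum /=.
  under eq_bigr do rewrite ReZ.
  move=> H; transitivity (\sum_i complex.Re (w 0 i) * M i j).
    by apply: eq_bigr => i _; rewrite mxE.
  by rewrite H /a /b; case: (c) (w 0 j) => p q [p' q'].
have YM : Y *m M = b *: X + a *: Y.
  apply/rowP => j; rewrite !mxE.
  have /(congr1 (@complex.Im R)) := wj j; rewrite raddf_sum /=.
  under eq_bigr do rewrite ImZ.
  move=> H; transitivity (\sum_i complex.Im (w 0 i) * M i j).
    by apply: eq_bigr => i _; rewrite mxE.
  rewrite H /a /b; case: (c) (w 0 j) => p q [p' q'] /=.
  by rewrite addrC.
have vecD r r' p q : vec (p *: r + q *: r') = p *: vec r + q *: vec r'.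
  rewrite /vec !scaler_sumr -big_split; apply: eq_bigr => i _ /=.
  by rewrite !mxE scalerDl !scalerA.
have fX : f (vec X) = a *: vec X + (- b) *: vec Y.
  by rewrite fvec XM -scaleNr vecD.
have fY : f (vec Y) = b *: vec X + a *: vec Y by rewrite fvec YM vecD.
have XY0 : (X != 0) || (Y != 0).
  rewrite -negb_and; apply: contraNN w0 => /andP[/eqP X0 /eqP Y0].
  apply/eqP/rowP => i; apply/eqP; rewrite mxE eq_complex.
  have /rowP/(_ i) := X0; have /rowP/(_ i) := Y0.
  by rewrite !mxE => -> -> /=; rewrite eqxx.
have b0 : b = 0.
  have := fS (vec X) (vec Y); rewrite fX fY (ipDl BP) (ipDr BP) !(ipZl BP) !(ipZr BP).
  move=> H; have {H} : b * (B (vec X) (vec X) + B (vec Y) (vec Y)) = 0 by lra.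
  move/eqP; rewrite mulf_eq0 => /orP[/eqP // | ].
  rewrite paddr_eq0 ?(ip_ge0 BP) // !(ip_eq0 BP) !vec0 -[_ && _]negbK negb_and.
  by rewrite XY0.
case/orP: XY0 => r0.
  by exists (vec X), a; rewrite vec0 fX b0 oppr0 scale0r addr0.
by exists (vec Y), a; rewrite vec0 fY b0 scale0r add0r.
Qed.

Lemma common_eigenvector (fs : seq 'End(V)) (U : {vspace V}) :
  (forall f, f \in fs -> ip_symmetric f) ->
  (forall f g, f \in fs -> g \in fs -> forall x, f (g x) = g (f x)) ->
  (forall f, f \in fs -> (f @: U <= U)%VS) -> U != 0%VS ->
  exists v, [/\ v \in U, v != 0 & forall f, f \in fs -> exists c, f v = c *: v].
Proof.
elim: fs U => [|f fs IH] U fS fC fU U0.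
  exists (vpick U); split; rewrite ?memv_pick ?vpick0 //.
have f_fs : f \in f :: fs by rewrite mem_head.
have sub g : g \in fs -> g \in f :: fs by rewrite in_cons orbC => ->.
have [v [c [vU v0 fv]]] := symmetric_eigenvector (fS _ f_fs) U0 (fU _ f_fs).
pose g0 : 'End(V) := f - c *: \1%VF; pose U' := (U :&: lker g0)%VS.
have U'P x : (x \in U') = (x \in U) && (f x == c *: x).
  by rewrite memv_cap memv_ker /g0 !lfun_simp subr_eq0.
have U'0 : U' != 0%VS.
  apply: contraNneq v0 => U'0.
  by rewrite -memv0 -U'0 U'P vU fv eqxx.
have [||g gfs|x [xU x0 xE]] := IH U' _ _ _ U'0.
- by move=> g /sub; apply: fS.
- by move=> g h /sub gS /sub hS; apply: fC.
- apply/subvP => _ /memv_imgP[x xU ->]; move: xU; rewrite !U'P => /andP[xU /eqP fx].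
  rewrite (subvP (fU _ (sub _ gfs))) ?memv_img //=.
  by rewrite (fC _ _ f_fs (sub _ gfs)) fx linearZ.
move: xU; rewrite U'P => /andP[xU /eqP fx].
exists x; split=> // g; rewrite in_cons => /orP[/eqP -> | /xE //].
by exists c.
Qed.

End SymmetricOperators.

(** * Strings of weights *)

Section Strings.
Variables (R : realType) (L V : lmodType R) (wt : L -> V -> Prop).
Hypothesis finite_wt : finite_set [set b | exists2 v, v != 0 & wt b v].

(** The representation theory of sl2 for raising and lowering operators [e], [f].
    From a vector u with [e u = 0] and weight of value m on the coroot one gets
    [e (f^(n+1) u) = d (n + 1) (m - n) f^n u]; so m is the least n such that
    [f^(n+1) u = 0], and all weights down to the reflected one occur. *)
Lemma string_int (e f : {linear V -> V}) (a : L) (c : L -> R) (d : R) :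
  a != 0 -> d != 0 -> c a = 2 -> (forall b b', c (b + b') = c b + c b') ->
  (forall b v, wt b v -> wt (b + a) (e v)) ->
  (forall b v, wt b v -> wt (b - a) (f v)) ->
  (forall b v, wt b v -> e (f v) - f (e v) = (d * c b) *: v) ->
  forall b v, v != 0 -> wt b v ->
  c b \is a Num.int /\
  (0 <= c b -> exists2 v', v' != 0 & wt (b - c b *: a) v').
Proof.
move=> a0 d0 ca cD we wf ef b v v0 wv.
have weights_fin (g : nat -> L) : injective g ->
    ~ (forall n, exists2 u, u != 0 & wt (g n) u).
  move=> gI H; apply: infinite_nat.
  apply: sub_finite_set (finite_preimage (in2W gI) finite_wt) => n _ /=.
  exact: H.
have scaleI : injective (fun n : nat => a *+ n).
  move=> m n /eqP; rewrite -[a *+ m]scaler_nat -[a *+ n]scaler_nat.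
  by rewrite -subr_eq0 -scalerBl scaler_eq0 (negPf a0) orbF subr_eq0 eqr_nat => /eqP.
have wen n : wt (b + a *+ n) (iter n e v).
  elim: n => [|n IH] /=; first by rewrite mulr0n addr0.
  by rewrite mulrSr addrA; apply: we.
have [p [vp0 evp]] : exists p, iter p e v != 0 /\ e (iter p e v) = 0.
  apply: contrapT => H.
  have en n : iter n e v != 0.
    elim: n => // n IH /=; apply/eqP => en0; apply: H; exists n; split=> //.
  apply: (weights_fin (fun n => b + a *+ n)) => [m n /addrI/scaleI // | n].
  by exists (iter n e v).
set u := iter p e v in vp0 evp; set b' := b + a *+ p; set m := c b'.
have wu : wt b' u by exact: wen.
have wfn n : wt (b' - a *+ n) (iter n f u).
  elim: n => [|n IH] /=; first by rewrite mulr0n subr0.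
  by rewrite mulrSr opprD addrA; apply: wf.
have cMn n : c (a *+ n) = 2 * n%:R.
  elim: n => [|n IH].
    by apply: (addrI (c 0)); rewrite mulr0 addr0 -cD addr0.
  by rewrite mulrSr cD IH ca -natr1; ring.
have cN x : c (- x) = - c x.
  apply/eqP; rewrite -addr_eq0 -cD addrC subrr; apply/eqP.
  by apply: (addrI (c 0)); rewrite -cD !addr0.
have efn n : e (iter n.+1 f u) = (d * (n.+1%:R * (m - n%:R))) *: iter n f u.
  elim: n => [|n IH].
    have /eqP := ef _ _ wu; rewrite /= evp linear0 subr0 => /eqP ->.
    by congr (_ *: _); rewrite -/m; ring.
  have /eqP := ef _ _ (wfn n.+1); rewrite IH linearZ /= subr_eq => /eqP ->.
  rewrite -scalerDl; congr (_ *: _).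
  by rewrite cD cN cMn -/m -!natr1; ring.
have [n [fn0 fSn]] : exists n, iter n f u != 0 /\ iter n.+1 f u = 0.
  apply: contrapT => H.
  have fn n : iter n f u != 0.
    elim: n => // n IH; apply/eqP => fn0; apply: H; exists n; split=> //.
  apply: (weights_fin (fun n => b' - a *+ n)) => [i j /addrI/oppr_inj/scaleI // | i].
  by exists (iter i f u).
have mn : m = n%:R.
  have /eqP := efn n; rewrite fSn linear0 eq_sym scaler_eq0 (negPf fn0) orbF.
  rewrite !mulf_eq0 (negPf d0) pnatr_eq0 /= subr_eq0 => /eqP //.
have cb : c b = n%:R - 2 * p%:R by rewrite -mn /m /b' cD cMn; ring.
split=> [|cb0].
  rewrite cb; apply: rpredB; first exact: rpred_nat.
  by apply: rpredM; exact: rpred_nat.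
have p2n : (p + p <= n)%N.
  by rewrite -(ler_nat R) natrD; move: cb0; rewrite cb; lra.
have pn : (p <= n)%N by apply: leq_trans (leq_addr _ _) p2n.
(* p steps lead from b up to b', and n - p steps from b' down to its reflection *)
exists (iter (n - p) f u).
  apply: contraNneq fn0 => H; rewrite -[n](subnKC pn) iterD H.
  by elim: (p) => //= i /eqP ->; rewrite linear0.
suff -> : b - c b *: a = b' - a *+ (n - p) by exact: wfn.
rewrite /b' -addrA; congr (_ + _).
rewrite -[a *+ p]scaler_nat -[a *+ _]scaler_nat -scalerBl -scaleNr; congr (_ *: _).
by rewrite cb natrB //; ring.
Qed.

End Strings.

(** * Root vectors of a compact Lie algebra *)

Section LieRing.
Variables (R : realType) (k : lieAlgType R).
Implicit Types x y z : k.

Lemma lieDl x y z : lie (x + y) z = lie x z + lie y z.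
Proof. by rewrite -[x]scale1r lie_linearl !scale1r. Qed.
Lemma lieDr x y z : lie x (y + z) = lie x y + lie x z.
Proof. by rewrite -[y]scale1r lie_linearr !scale1r. Qed.
Lemma lie0l x : lie 0 x = 0.
Proof. by apply: (addrI (lie 0 x)); rewrite -lieDl !addr0. Qed.
Lemma lie0r x : lie x 0 = 0.
Proof. by apply: (addrI (lie x 0)); rewrite -lieDr !addr0. Qed.
Lemma lieZl (a : R) x y : lie (a *: x) y = a *: lie x y.
Proof. by rewrite -[_ *: x]addr0 lie_linearl lie0l addr0. Qed.
Lemma lieZr (a : R) x y : lie x (a *: y) = a *: lie x y.
Proof. by rewrite -[_ *: y]addr0 lie_linearr lie0r addr0. Qed.
Lemma lieNl x y : lie (- x) y = - lie x y.
Proof. by rewrite -scaleN1r lieZl scaleN1r. Qed.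
Lemma lieNr x y : lie x (- y) = - lie x y.
Proof. by rewrite -scaleN1r lieZr scaleN1r. Qed.
Lemma lieC x y : lie x y = - lie y x.
Proof.
apply/eqP; rewrite -addr_eq0; apply/eqP.
by have := lie_alt (x + y); rewrite lieDl !lieDr !lie_alt add0r addr0.
Qed.

Lemma lie_leibniz x y z : lie x (lie y z) = lie (lie x y) z + lie y (lie x z).
Proof.
have /eqP := lie_jacobi x y z; rewrite addr_eq0 => /eqP xyz.
apply/eqP; rewrite -subr_eq0 opprD addrA addrAC -lieNr -(lieC z x) xyz.
by rewrite (lieC z) opprK subrr.
Qed.

(** The bracket of the complexification, elements X + i Y being pairs (X, Y). *)
Definition clie (P Q : k * k) : k * k :=
  (lie P.1 Q.1 - lie P.2 Q.2, lie P.1 Q.2 + lie P.2 Q.1).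

Lemma clie_linear P : linear (clie P).
Proof.
move=> r Q S; congr (_, _); rewrite /= !(lieDr, lieZr).
  by rewrite scalerBr opprD addrACA.
by rewrite scalerDr addrACA.
Qed.

HB.instance Definition _ P := GRing.isLinear.Build R _ _ _ (clie P) (@clie_linear P).

Lemma clie_leibniz P Q S :
  clie P (clie Q S) = clie (clie P Q) S + clie Q (clie P S).
Proof.
congr (_, _); rewrite /= !(lieDr, lieDl, lieNr, lieNl).
  rewrite !(lie_leibniz P.1 _ _) !(lie_leibniz P.2 _ _) !opprD !addrA.
  by rewrite [LHS](ACl (1*7*3*5*2*6*4*8)%AC).
rewrite !(lie_leibniz P.1 _ _) !(lie_leibniz P.2 _ _) !opprD !addrA.
by rewrite [LHS](ACl (1*7*3*5*2*6*4*8)%AC).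
Qed.

End LieRing.

Section CompactLie.
Variables (R : realType) (k : lieAlgType R) (B : k -> k -> R) (t : {vspace k}).
Hypotheses (BI : invariant_inner_product B) (tC : cartan_subalgebra t).
Local Notation T := (subvs_of t).
Local Notation D := ('Hom(subvs_of t, R^o)).
Implicit Types (a b : D) (h : T) (S : k * k).

Lemma invariant_ip : inner_product B. Proof. by case: BI. Qed.
Let BP := invariant_ip.

Lemma ip_lie x y z : B (lie x y) z = - B y (lie x z). Proof. by case: BI. Qed.

Lemma cartan_lie0 h h' : lie (vsval h) (vsval h') = 0.
Proof. by case: tC => tA _; apply: tA; apply: subvsP. Qed.

(** Adjoining a centralising element to a maximal abelian subalgebra keeps it
    abelian. *)
Lemma cartan_centraliser z : (forall h, lie (vsval h) z = 0) -> z \in t.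
Proof.
move=> zt; have [tA tmax] := tC.
have tz x : x \in t -> lie x z = 0.
  by move=> xt; rewrite -(vsprojK xt).
have <- : (t + <[z]>)%VS = t.
  apply: tmax (addvSl _ _) => x y /memv_addP[u ut [_ /vlineP[r ->] ->]].
  case/memv_addP=> [v vt [_ /vlineP[s ->] ->]].
  rewrite !(lieDl, lieDr, lieZl, lieZr) tA // tz // lie_alt (lieC z) tz //.
  by rewrite oppr0 !scaler0 !addr0.
by rewrite memvE addvSr.
Qed.

(** The isomorphism of the dual of [t] with [t] given by the inner product. *)
Definition flat : 'Hom(T, D) :=
  linfun (fun h => linfun (fun h' => B (vsval h) (vsval h') : R^o)).

Lemma flatE h h' : flat h h' = B (vsval h) (vsval h').
Proof.
have lin2 h1 : linear (fun h' => B (vsval h1) (vsval h') : R^o).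
  by move=> r x y; rewrite linearD linearZ /= (ipDr BP) (ipZr BP).
rewrite /flat linfunE ?linfunE // => r x y; apply/lfunP => z.
rewrite add_lfunE scale_lfunE !linfunE //.
by rewrite linearD linearZ /= (ipDl BP) (ipZl BP).
Qed.

Lemma flat_inj : lker flat == 0%VS.
Proof.
apply/lker0P => h h' /(congr1 (fun l : D => l (h - h'))).
rewrite !flatE => /eqP; rewrite -subr_eq0 -(ipBl BP) -linearB /= (ip_eq0 BP).
by rewrite subr_eq0 => /eqP/val_inj.
Qed.

Lemma form_scale a r h : a (r *: h) = r * a h :> R.
Proof. by rewrite linearZ. Qed.

Definition sharp : 'Hom(D, T) := (flat^-1)%VF.

Lemma sharpK a : flat (sharp a) = a.
Proof.
have dD : \dim {:D} = \dim {:T} by rewrite !dimvf /dim /= muln1.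
have flat_onto : limg flat = fullv.
  apply/eqP; rewrite eqEdim subvf /= limg_dim_eq ?dD //.
  by rewrite (eqP flat_inj) capv0.
by apply: limg_lfunVK; rewrite flat_onto memvf.
Qed.

Lemma sharpE a h : B (vsval (sharp a)) (vsval h) = a h.
Proof. by rewrite -flatE sharpK. Qed.

Definition dual_ip a b : R := a (sharp b).

Lemma dual_ipE a b : dual_ip a b = B (vsval (sharp a)) (vsval (sharp b)).
Proof. by rewrite sharpE. Qed.

Lemma dual_ipP : inner_product dual_ip.
Proof.
split=> [y r x x' | x y | x x0].
- by rewrite /dual_ip add_lfunE scale_lfunE.
- by rewrite !dual_ipE (ipC BP).
rewrite dual_ipE (ip_gt0 BP); apply: contraNneq x0 => sx.
rewrite -(sharpK x); have -> : sharp x = 0 by apply: val_inj; exact: sx.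
by rewrite linear0.
Qed.

(** Weight vectors of the complexified adjoint representation. *)
Definition weight_vector a S := root_vector a S.1 S.2.

Lemma weight_clie a b P S :
  weight_vector a P -> weight_vector b S -> weight_vector (a + b) (clie P S).
Proof.
move=> aP bS h; have [aP1 aP2] := aP h; have [bS1 bS2] := bS h.
rewrite add_lfunE /= !(lieDr, lieNr) !(lie_leibniz (vsval h) _ _) aP1 aP2 bS1 bS2.
rewrite !(lieZl, lieZr) (mulrDr (2 * pi)).
move: (2 * pi * a h) (2 * pi * b h) => r q.
rewrite !scalerDr !scaleNr !scalerN !scalerDl !opprD !addrA; split.
  by rewrite [LHS](ACl (3*2*1*4)%AC).
by rewrite [LHS](ACl (3*2*1*4)%AC).
Qed.

Definition conj_pair S : k * k := (S.1, - S.2).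

Lemma weight_conj a S : weight_vector a S -> weight_vector (- a) (conj_pair S).
Proof.
move=> aS h; have [aS1 aS2] := aS h; rewrite /= lieNr aS1 aS2.
have -> : 2 * pi * (- a) h = - (2 * pi * a h) :> R by rewrite opp_lfunE; apply: mulrN.
by rewrite opprK scalerN !scaleNr.
Qed.

Lemma root_vector_eq_norm a X Y : a != 0 -> root_vector a X Y -> B X X = B Y Y.
Proof.
move=> a0 aXY.
have [h ah] : exists h, a h != 0.
  apply: contrapT => H; case/eqP: a0; apply/lfunP => h; rewrite zero_lfunE.
  by apply: contrapT => /eqP ah; apply: H; exists h.
have [hX hY] := aXY h; have := ip_lie (vsval h) X Y.
rewrite hX hY (ipZl BP) (ipZr BP) mulNr => /oppr_inj/esym.
by apply: mulfI; rewrite !mulf_neq0 // ?pnatr_eq0 // gt_eqF // pi_gt0.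
Qed.

(** The bracket centralises [t], hence lies in [t], where it is determined by its
    inner products B([X, Y], h) = B(Y, [h, X]). *)
Lemma root_vector_lie a X Y : root_vector a X Y ->
  lie X Y = - (2 * pi * B Y Y) *: vsval (sharp a).
Proof.
move=> aXY.
have XYt : lie X Y \in t.
  apply: cartan_centraliser => h; have [hX hY] := aXY h.
  by rewrite lie_leibniz hX hY lieZl lieZr !lie_alt !scaler0 addr0.
rewrite -(vsprojK XYt); set z := vsproj t _.
have zE h : B (vsval z) (vsval h) = - (2 * pi * B Y Y) * a h.
  have [hX hY] := aXY h; rewrite /z vsprojK // ip_lie (lieC X) hX (ipNr BP).
  by rewrite (ipZr BP); ring.
suff -> : z = - (2 * pi * B Y Y) *: sharp a by rewrite linearZ.
apply/(lker0P flat_inj)/lfunP => h.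
have -> : flat (- (2 * pi * B Y Y) *: sharp a) = - (2 * pi * B Y Y) *: a.
  by rewrite linearZ /= sharpK.
by rewrite flatE zE scale_lfunE.
Qed.

Definition weight a := exists2 S, S != 0 & weight_vector a S.

Lemma rootsP a : Defs.roots t a <-> a != 0 /\ weight a.
Proof.
split=> [[a0 [X [Y [XY aXY]]]] | [a0 [[X Y] XY aXY]]]; split=> //.
  exists (X, Y) => //; move: XY; apply: contraTneq => -[-> ->].
  by rewrite eqxx.
exists X, Y; split=> //; move: XY; apply: contraNT; rewrite negb_or !negbK.
by move=> /andP[/eqP -> /eqP ->].
Qed.

Lemma dual_ip_gt0 a : a != 0 -> 0 < a (sharp a).
Proof. by move=> a0; rewrite -[a _]/(dual_ip a a) (ip_gt0 dual_ipP). Qed.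

Lemma root_vector_ip_gt0 a X Y : a != 0 -> root_vector a X Y ->
  (X != 0) || (Y != 0) -> 0 < B Y Y.
Proof.
move=> a0 aXY; rewrite (ip_gt0 BP) -(ip_eq0 BP X) (root_vector_eq_norm a0 aXY).
by rewrite (ip_eq0 BP) orbb.
Qed.

(** The lines spanned by the brackets [X, Y] are all equal, so that the choice made
    in the definition of the coroot is immaterial. *)
Lemma coroot_sharp a : Defs.roots t a -> coroot a = (2 / a (sharp a)) *: sharp a.
Proof.
move=> [a0 [X [Y [XY aXY]]]]; have sa := dual_ip_gt0 a0.
have Y0 := root_vector_ip_gt0 a0 aXY XY.
have p0 : (0 : R) < 2 * pi * B Y Y by rewrite !mulr_gt0 // pi_gt0.
apply: xget_unique.
  split; first by rewrite form_scale divfK // gt_eqF.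
  exists X, Y, (- (2 / a (sharp a)) / (2 * pi * B Y Y)); split=> //.
  rewrite (root_vector_lie aXY) scalerA linearZ /=; congr (_ *: _).
  by rewrite mulNr mulrNN divfK // gt_eqF.
move=> h [ah [X' [Y' [r [aXY' hE]]]]].
have {hE} hE : h = (r * - (2 * pi * B Y' Y')) *: sharp a.
  by apply: val_inj; apply: etrans hE _; rewrite (root_vector_lie aXY') scalerA.
move: ah; rewrite hE form_scale; set s := r * _ => sE; congr (_ *: _).
by rewrite -sE mulfK // gt_eqF.
Qed.

Lemma coroot_cart a (l : D) : Defs.roots t a -> l (coroot a) = cart dual_ip a l.
Proof.
move=> aP; rewrite (coroot_sharp aP) form_scale /cart /dual_ip.
by rewrite mulrAC.
Qed.

Lemma reflection_srefl a : Defs.roots t a -> reflection a = srefl dual_ip a.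
Proof.
move=> aP; rewrite /reflection /srefl; congr linfun; apply: funext => l.
by rewrite coroot_cart.
Qed.

(** * Weights of the adjoint representation *)

(** The operator 1/i ad h on the complexification, restricted to real scalars: it
    is symmetric and acts on vectors of weight [a] as the scalar 2 pi a(h). *)
Definition ad_op h : 'End(k * k)%type :=
  linfun (fun S => (lie (vsval h) S.2, - lie (vsval h) S.1)).

Lemma ad_opE h S : ad_op h S = (lie (vsval h) S.2, - lie (vsval h) S.1).
Proof.
rewrite /ad_op linfunE // => r x y; rewrite /= !(lieDr, lieZr).
by rewrite opprD -scalerN.
Qed.

Lemma weight_vectorP a S :
  weight_vector a S <-> forall h, ad_op h S = (2 * pi * a h) *: S.
Proof.
split=> aS h.
  have [S1 S2] := aS h; rewrite ad_opE S1 S2 scaleNr opprK.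
  by rewrite [in RHS](surjective_pairing S).
have := aS h; rewrite ad_opE [in RHS](surjective_pairing S) => -[-> /eqP].
by rewrite eqr_oppLR scaleNr => /eqP ->.
Qed.

Definition pair_ip S S' : R := B S.1 S'.1 + B S.2 S'.2.

Lemma pair_ipP : inner_product pair_ip.
Proof.
split=> [y r x x' | x y | x x0]; rewrite /pair_ip /=.
- by rewrite !(ipDl BP) !(ipZl BP); ring.
- by rewrite !(ipC BP x.1) !(ipC BP x.2).
rewrite lt_neqAle addr_ge0 ?(ip_ge0 BP) // andbT eq_sym.
rewrite paddr_eq0 ?(ip_ge0 BP) // !(ip_eq0 BP); apply: contraNN x0.
by case: x => x1 x2 /= /andP[/eqP -> /eqP ->].
Qed.

Lemma ad_op_symmetric h : ip_symmetric pair_ip (ad_op h).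
Proof.
move=> S S'; rewrite /pair_ip !ad_opE /= (ipNl BP) !ip_lie (ipNr BP).
by rewrite opprK addrC.
Qed.

Lemma ad_op_comm h h' S : ad_op h (ad_op h' S) = ad_op h' (ad_op h S).
Proof.
rewrite !ad_opE /= !lieNr !(lie_leibniz (vsval h)) !cartan_lie0 !lie0l !add0r.
by [].
Qed.

(** The values of a weight on a basis of [t] are, up to the factor 2 pi,
    eigenvalues of the operators [ad_op]. *)
Lemma finite_weights : finite_set [set a | weight a].
Proof.
pose e := vbasis {:T}; have eB : basis_of {:T} e := vbasisP _.
pose X i := fset_set [set c | exists2 v, v != 0 & ad_op e`_i v = c *: v].
pose s := flatten [seq enum_fset (X i) | i : 'I_(\dim {:T})].
pose f a := [ffun i : 'I_(\dim {:T}) => insub (2 * pi * a e`_i) : option (seq_sub s)].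
apply: (finite_set_injP (f := f)) => a b [S S0 aS] [S' S'0 bS'] /ffunP fab.
have mem (a' : D) S1 (i : 'I_(\dim {:T})) : S1 != 0 -> weight_vector a' S1 ->
    2 * pi * a' e`_i \in s.
  move=> S10 /weight_vectorP aS1; apply/flattenP; exists (enum_fset (X i)).
    by apply/mapP; exists i; rewrite ?mem_enum.
  rewrite in_fset_set; last exact: finite_eigenvalues.
  by apply/mem_set; exists S1.
have ab (i : 'I_(\dim {:T})) : a e`_i = b e`_i.
  have := fab i; rewrite !ffunE !insubT ?(mem a S) ?(mem b S') // => ? ? [].
  by apply: mulfI; rewrite mulf_neq0 ?pnatr_eq0 // gt_eqF // pi_gt0.
apply/lfunP => h; rewrite (coord_basis eB (memvf h)) !linear_sum.
by apply: eq_bigr => i _; rewrite !linearZ /= ab.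
Qed.

Lemma clie_comm a b P S : weight_vector a P -> weight_vector b S -> a != 0 ->
  clie P (clie (conj_pair P) S) - clie (conj_pair P) (clie P S) =
  (- (4 * pi ^+ 2 * B P.2 P.2 * a (sharp a)) * cart dual_ip a b) *: S.
Proof.
move=> aP bS a0; rewrite clie_leibniz addrK.
have sa := dual_ip_gt0 a0.
pose z := (4 * pi * B P.2 P.2) *: sharp a.
have -> : clie P (conj_pair P) = (0, vsval z).
  rewrite /clie /= lie_alt !lieNr lie_alt oppr0 subr0 (lieC P.2).
  rewrite (root_vector_lie aP) scaleNr opprK -scalerDl.
  by congr (_, _ *: _); ring.
have [zS1 zS2] := bS z; rewrite /clie /= !lie0l zS1 zS2 sub0r add0r.
rewrite [in RHS](surjective_pairing S) -scaleNr.
rewrite (_ : - (2 * pi * b z) =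
  - (4 * pi ^+ 2 * B P.2 P.2 * a (sharp a)) * cart dual_ip a b) //.
rewrite form_scale /cart /dual_ip; by field; rewrite gt_eqF.
Qed.

Lemma root_pairP a : Defs.roots t a -> exists P,
  [/\ weight_vector a P, 4 * pi ^+ 2 * B P.2 P.2 * a (sharp a) != 0 & P != 0].
Proof.
move=> [a0 [X [Y [XY aXY]]]]; exists (X, Y); split=> //.
  have Y0 := root_vector_ip_gt0 a0 aXY XY.
  by rewrite !mulf_neq0 ?pnatr_eq0 ?expf_neq0 ?gt_eqF ?dual_ip_gt0 ?pi_gt0.
by move: XY; apply: contraTneq => -[-> ->]; rewrite eqxx.
Qed.

(** The string of weights through [b] in the direction [a] is followed downwards or
    upwards according to the sign of the Cartan number. *)
Lemma cart_weight a b : Defs.roots t a -> weight b ->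
  cart dual_ip a b \is a Num.int /\ weight (b - cart dual_ip a b *: a).
Proof.
move=> aR [S S0 bS]; have [P [aP d0 _]] := root_pairP aR.
have a0 : a != 0 by case: aR.
have cD := cartD dual_ipP a.
have ca := cart_id dual_ipP a0.
have up (Q : k * k) a' b' v : weight_vector a' Q -> weight_vector b' v ->
    weight_vector (b' + a') (clie Q v).
  by rewrite addrC; apply: weight_clie.
have aP' := weight_conj aP.
pose d := - (4 * pi ^+ 2 * B P.2 P.2 * a (sharp a)).
have {}d0 : d != 0 by rewrite oppr_eq0.
have [cI cpos] := string_int finite_weights (e := clie P) (f := clie (conj_pair P))
  a0 d0 ca cD (fun b' v => up P a b' v aP) (fun b' v => up _ _ b' v aP')
  (fun b' v H => clie_comm aP H a0) S0 bS.
have na0 : - a != 0 by rewrite oppr_eq0.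
pose c' x := - cart dual_ip a x.
have c'D x y : c' (x + y) = c' x + c' y by rewrite /c' cD opprD.
have c'a : c' (- a) = 2 by rewrite /c' (cartN dual_ipP) opprK.
have up' b' v : weight_vector b' v -> weight_vector (b' - - a) (clie P v).
  by rewrite opprK; apply: up.
have comm' b' v : weight_vector b' v ->
    clie (conj_pair P) (clie P v) - clie P (clie (conj_pair P) v) = (d * c' b') *: v.
  move=> bv; rewrite -opprB (clie_comm aP bv a0) -scaleNr /c' -/d mulrN.
  by [].
have [_ cneg] := string_int finite_weights (e := clie (conj_pair P)) (f := clie P)
  na0 d0 c'a c'D (fun b' v => up _ _ b' v aP') up' comm' S0 bS.
split=> //; have [c0 | c0] := leP 0 (cart dual_ip a b).
  by have [v v0 bv] := cpos c0; exists v.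
have [|v v0] := cneg; first by rewrite oppr_ge0 ltW.
by rewrite /c' scaleNr scalerN opprK => bv; exists v.
Qed.

(** If 2a were a root with vector v, then F v has weight a and F F v weight 0, so
    that E E F F v = 0 for the raising and lowering operators E, F of a; as 3a is
    no weight, E v = 0, and E E F F v is also a nonzero multiple of v. *)
Lemma roots_reduced a : Defs.roots t a -> ~ Defs.roots t (2 *: a).
Proof.
move=> aR aR2; have a0 : a != 0 by case: aR.
have [P [aP d0 P0]] := root_pairP aR.
pose d := - (4 * pi ^+ 2 * B P.2 P.2 * a (sharp a)).
have {}d0 : d != 0 by rewrite oppr_eq0.
have aP' := weight_conj aP.
have wa : weight a by exists P.
have ca r : cart dual_ip a (r *: a) = r * 2 by rewrite (cartZ dual_ipP) (cart_id dual_ipP).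
case: aR2 => a20 [V1 [V2 [VV vP]]]; pose v : k * k := (V1, V2).
have v0 : v != 0.
  by move: VV; apply: contraTneq => -[-> ->]; rewrite eqxx.
have {}vP : weight_vector (2 *: a) v by [].
(* 3a is not a root: the value of a on its coroot would be 2/3 *)
have Ev : clie P v = 0.
  apply/eqP; apply: contraT => Ev0.
  have a3 : a + 2 *: a = 3 *: a by rewrite -{1}[a]scale1r -scalerDl; congr (_ *: _); ring.
  have a3R : Defs.roots t (3 *: a).
    apply/rootsP; rewrite scaler_eq0 (negPf a0) orbF pnatr_eq0; split=> //.
    by exists (clie P v) => //; rewrite -a3; apply: weight_clie.
  have [] := cart_weight a3R wa.
  have -> : cart dual_ip (3 *: a) a = 2 / 3.
    rewrite /cart !(ipZl dual_ipP) !(ipZr dual_ipP).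
    by field; rewrite gt_eqF // (ip_gt0 dual_ipP).
  move=> /intrP[n nE] _; have : (n * 3)%:~R = 2%:~R :> R by rewrite intrM -nE; field.
  by move/intr_inj; case: n {nE} => -[|[|[|n]]].
pose F := clie (conj_pair P).
have wF b w : weight_vector b w -> weight_vector (b - a) (F w).
  by rewrite addrC; apply: weight_clie.
have comm b w : weight_vector b w ->
    clie P (F w) = F (clie P w) + (d * cart dual_ip a b) *: w.
  by move=> bw; rewrite -(clie_comm aP bw a0) addrC subrK.
have aa : 2 *: a - a = a by rewrite scaler_nat mulr2n addrK.
have Fv := wF _ _ vP; rewrite aa in Fv.
have FFv := wF _ _ Fv; rewrite subrr in FFv.
have EFv : clie P (F v) = (d * 4) *: v.
  rewrite (comm _ _ vP) Ev /F linear0 add0r ca; congr (_ *: _); by ring.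
have EFFv : clie P (F (F v)) = (d * 6) *: F v.
  rewrite (comm _ _ Fv) EFv /F linearZ /= -scalerDl; congr (_ *: _).
  by rewrite -[X in cart _ a X]scale1r ca; ring.
have : clie P (clie P (F (F v))) = (d * 6) * (d * 4) *: v.
  by rewrite EFFv linearZ /= EFv scalerA.
have tF : (F (F v)).1 \in t /\ (F (F v)).2 \in t.
  split; apply: cartan_centraliser => h.
    by have [-> _] := FFv h; rewrite zero_lfunE mulr0 oppr0 scale0r.
  by have [_ ->] := FFv h; rewrite zero_lfunE mulr0 scale0r.
have -> : clie P (clie P (F (F v))) = 0.
  case: tF; move: (F (F v)) => [w1 w2] /= w1t w2t.
  rewrite -(vsprojK w1t) -(vsprojK w2t); move: (vsproj t w1) (vsproj t w2) => h1 h2.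
  have [h1P1 h1P2] := aP h1; have [h2P1 h2P2] := aP h2.
  have -> : clie P (vsval h1, vsval h2) =
      ((2 * pi * a h1) *: P.2 + (2 * pi * a h2) *: P.1,
       (2 * pi * a h2) *: P.2 - (2 * pi * a h1) *: P.1).
    rewrite /clie /= !(lieC P.1) !(lieC P.2) h1P1 h1P2 h2P1 h2P2.
    by rewrite !scaleNr !opprK.
  move: (2 * pi * a h1) (2 * pi * a h2) => r q; rewrite /clie /=.
  rewrite !(lieDr, lieNr, lieZr) !lie_alt (lieC P.2 P.1) !scaler0 !scalerN oppr0.
  by rewrite !addr0 !sub0r !opprK !subrr.
move=> /esym/eqP; rewrite scaler_eq0 (negPf v0) orbF !mulf_eq0 (negPf d0) !pnatr_eq0.
by [].
Qed.

Lemma cartan_neq0 : (0 < \dim {:k})%N -> t != 0%VS.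
Proof.
move=> k0; have [tA tmax] := tC; apply/eqP => t0.
have z0 : vpick {:k} != 0 by rewrite vpick0 -dimv_eq0 -lt0n.
have : <[vpick {:k}]>%VS = t.
  apply: tmax; last by rewrite t0 sub0v.
  move=> x y /vlineP[r ->] /vlineP[s ->].
  by rewrite lieZl lieZr lie_alt !scaler0.
by move/eqP; rewrite t0 -dimv_eq0 dim_vline z0.
Qed.

(** An element h with ad h = 0 spans an abelian ideal. Otherwise the operators
    [ad_op] have a common eigenvector in the image of [ad_op h], which is orthogonal
    to its kernel. *)
Lemma roots_separate h : semisimple_lie k ->
  (forall a, Defs.roots t a -> a h = 0 :> R) -> h = 0.
Proof.
move=> kS h0; apply/eqP/contraT => hn0.
have [ad0 | adn0] := eqVneq (ad_op h) 0.
  have central x : lie (vsval h) x = 0.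
    have := congr1 (fun f : 'End((k * k)%type) => f (0, x)) ad0.
    by rewrite ad_opE zero_lfunE => -[].
  suff : <[vsval h]>%VS = 0%VS.
    move/eqP; rewrite -dimv_eq0 dim_vline eqb0 negbK => /eqP hh.
    by case/eqP: hn0; apply: val_inj.
  apply: kS => x y.
    by move=> /vlineP[r ->]; rewrite lieZr lieC central oppr0 scaler0 mem0v.
  by move=> /vlineP[r ->] _; rewrite lieZl central scaler0.
pose e := vbasis {:T}; have eB : basis_of {:T} e := vbasisP _.
pose fs := [seq ad_op h' | h' <- e].
have U0 : limg (ad_op h) != 0%VS.
  apply: contraNneq adn0 => U0; apply/eqP/lfunP => S; rewrite zero_lfunE.
  by apply/eqP; rewrite -memv0 -U0 memv_img ?memvf.
have [||f fS|S [SU S0 Sfs]] := common_eigenvector pair_ipP (fs := fs) _ _ _ U0.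
- by move=> _ /mapP[h' _ ->]; apply: ad_op_symmetric.
- by move=> _ _ /mapP[h1 _ ->] /mapP[h2 _ ->] S; apply: ad_op_comm.
- case/mapP: fS => h' _ ->; apply/subvP => _ /memv_imgP[_ /memv_imgP[S _ ->] ->].
  by rewrite ad_op_comm memv_img ?memvf.
have SS : pair_ip S S != 0 by rewrite (ip_eq0 pair_ipP).
have pi0 : 2 * pi != 0 :> R by rewrite mulf_neq0 ?pnatr_eq0 // gt_eqF ?pi_gt0.
have ad_lin S1 r h1 h2 : ad_op (r *: h1 + h2) S1 = r *: ad_op h1 S1 + ad_op h2 S1.
  rewrite !ad_opE linearD linearZ /= !lieDl !lieZl; congr (_, _).
  by rewrite /= opprD scalerN.
have eig h' : exists c, ad_op h' S = c *: S.
  rewrite (coord_basis eB (memvf h')).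
  have ad_sum (I : Type) (r : seq I) (F : I -> T) :
      (forall i, exists c, ad_op (F i) S = c *: S) ->
      exists c, ad_op (\sum_(i <- r) F i) S = c *: S.
    move=> FS; elim: r => [|i r [c cE]].
      by exists 0; rewrite big_nil ad_opE !lie0l oppr0 scale0r.
    have [c' c'E] := FS i; exists (c' + c); rewrite big_cons scalerDl -c'E -cE.
    by rewrite -{1}[F i]scale1r ad_lin scale1r.
  apply: ad_sum => i; have [|c cE] := Sfs (ad_op e`_i).
    by apply/mapP; exists e`_i; rewrite ?mem_nth ?size_tuple.
  exists (coord e i h' * c); rewrite -[X in ad_op X]addr0 ad_lin cE scalerA.
  by rewrite ad_opE !lie0l oppr0 addr0.
pose b : D := linfun (fun h' => pair_ip (ad_op h' S) S / (2 * pi * pair_ip S S) : R^o).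
have bE h' : b h' = pair_ip (ad_op h' S) S / (2 * pi * pair_ip S S).
  rewrite /b linfunE // => r h1 h2.
  rewrite ad_lin (ipDl pair_ipP) (ipZl pair_ipP) mulrDl; congr (_ + _).
  by rewrite -[RHS]/(r * _) mulrA.
have bS : weight_vector b S.
  apply/weight_vectorP => h'; have [c cE] := eig h'.
  rewrite bE cE (ipZl pair_ipP); congr (_ *: _).
  move: (2 * pi) (pair_ip S S) pi0 SS => m q m0 q0.
  by field; rewrite m0 q0.
have bh : b h != 0.
  case/memv_imgP: SU => S' _ SE; apply: contraNneq SS => bh.
  rewrite {2}SE -ad_op_symmetric (proj1 (weight_vectorP b S) bS) bh mulr0 scale0r.
  by rewrite (ip0l pair_ipP).
have b0 : b != 0 by apply: contraNneq bh => ->; rewrite zero_lfunE.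
have bR : Defs.roots t b by apply/rootsP; split=> //; exists S.
by rewrite (h0 b bR) eqxx in bh.
Qed.

Lemma finite_roots : finite_set (Defs.roots t).
Proof. by apply: sub_finite_set finite_weights => a /rootsP[]. Qed.

Definition root_fset : {fset D} := fset_set (Defs.roots t).

Lemma root_fsetP a : a \in root_fset <-> Defs.roots t a.
Proof.
rewrite in_fset_set; last exact: finite_roots.
by split=> [/set_mem | /mem_set].
Qed.

Lemma compact_root_system : semisimple_lie k -> root_system dual_ip root_fset.
Proof.
move=> kS; have ipP := dual_ipP.
have weightR a : Defs.roots t a -> weight a by case/rootsP.
split=> //.
- by move=> a /root_fsetP[].
- move=> a b /root_fsetP aR /root_fsetP bR; apply/root_fsetP/rootsP; split.
    apply/eqP => /(congr1 (srefl dual_ip a)); rewrite sreflK // linear0.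
    by apply/eqP; case: bR.
  by rewrite sreflE //; have [] := cart_weight aR (weightR _ bR).
- move=> a b /root_fsetP aR /root_fsetP bR.
  by have [] := cart_weight aR (weightR _ bR).
- move=> a /root_fsetP aR; apply/negP => /root_fsetP; exact: roots_reduced.
move=> x xa; suff sx : sharp x = 0 by rewrite -(sharpK x) sx linear0.
apply: (roots_separate kS) => a /root_fsetP/xa.
by rewrite (ipC ipP).
Qed.

Lemma roots_nonempty : semisimple_lie k -> (0 < \dim {:k})%N -> exists a, a \in root_fset.
Proof.
move=> kS k0; apply: contrapT => no_root.
have t0 := cartan_neq0 k0.
have : vsproj t (vpick t) = 0.
  apply: (roots_separate kS) => a /root_fsetP aR.
  by case: no_root; exists a.
move/(congr1 vsval); rewrite vsprojK ?memv_pick // linear0 => /eqP.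
by rewrite vpick0 (negPf t0).
Qed.

End CompactLie.

(** * Exponentials of even forms *)

Section NilpotentExponential.
Variables (R : realType) (A : comUnitAlgType R[i]).
Implicit Types a b : A.

Let e a n : A := n`!%:R^-1 *: a ^+ n.

Lemma nilexpE a N : a ^+ N = 0 -> nilexp a = \sum_(n < N) e a n.
Proof.
move=> aN; rewrite /nilexp fsbig_ord; apply/esym/fsbig_widen => // n [_ /= nN].
rewrite /e -(subnK (n := n) (m := N)) ?exprD ?aN ?mulr0 ?scaler0 //.
by rewrite leqNgt; apply/negP.
Qed.

Lemma nilpotent_exp a N n : a ^+ N = 0 -> (N <= n)%N -> a ^+ n = 0.
Proof. by move=> aN /subnK <-; rewrite exprD aN mulr0. Qed.

(** The truncated exponential series as a polynomial: the coefficients of the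
    product of two of them are the terms of the exponential series of the sum. *)
Definition exp_poly a N : {poly A} := \poly_(n < N) e a n.

Lemma exp_polyE a N n : a ^+ N = 0 -> (exp_poly a N)`_n = e a n.
Proof.
move=> aN; rewrite coef_poly; case: ltnP => // Nn.
by rewrite /e (nilpotent_exp aN Nn) scaler0.
Qed.

Lemma exp_polyD a b N n : a ^+ N = 0 -> b ^+ N = 0 ->
  (exp_poly a N * exp_poly b N)`_n = e (a + b) n.
Proof.
move=> aN bN; rewrite coefMr /e exprDn scaler_sumr; apply: eq_bigr => i _.
rewrite !exp_polyE // /e -scalerAl -scalerAr scalerA -scalerMnr -scaler_nat scalerA.
congr (_ *: _); have in_ : (i <= n)%N by rewrite -ltnS.
have f0 m : m`!%:R != 0 :> R[i] by rewrite pnatr_eq0 -lt0n fact_gt0.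
rewrite -(bin_fact in_) !natrM; field.
by rewrite !f0 pnatr_eq0 -lt0n bin_gt0.
Qed.

(** The product of the two truncated exponentials has degree less than 2 N. *)
Lemma exprD_eq0 a b N : a ^+ N = 0 -> b ^+ N = 0 -> (a + b) ^+ (N + N) = 0.
Proof.
move=> aN bN; have := exp_polyD (N + N) aN bN.
rewrite nth_default => [/esym/eqP|].
  rewrite /e scaler_eq0 invr_eq0 pnatr_eq0 -leqn0 leqNgt fact_gt0 /= => /eqP //.
apply: leq_trans (size_polyMleq _ _) _.
have sa := size_poly N (e a); have sb := size_poly N (e b).
by apply: leq_trans (leq_pred _) _; apply: leq_add.
Qed.

Lemma nilpotentD a b : nilpotent a -> nilpotent b -> nilpotent (a + b).
Proof.
move=> [m am] [n bn]; exists (maxn m n + maxn m n)%N.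
by apply: exprD_eq0; [apply: nilpotent_exp am _ | apply: nilpotent_exp bn _];
  rewrite leq_max leqnn ?orbT.
Qed.

Lemma nilexpD a b : nilpotent a -> nilpotent b ->
  nilexp (a + b) = nilexp a * nilexp b.
Proof.
move=> [m am] [n bn]; pose N := maxn m n.
have aN : a ^+ N = 0 by apply: nilpotent_exp am _; rewrite leq_max leqnn.
have bN : b ^+ N = 0 by apply: nilpotent_exp bn _; rewrite leq_max leqnn orbT.
have hE c : c ^+ N = 0 -> nilexp c = (exp_poly c N).[1].
  move=> cN; rewrite (nilexpE cN) (horner_coef_wide _ (size_poly _ _)).
  by apply: eq_bigr => i _; rewrite expr1n mulr1 exp_polyE.
rewrite (nilexpE (exprD_eq0 aN bN)) (hE a) // (hE b) // -hornerM.
rewrite (@horner_coef_wide _ (N + N)); last first.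
  apply: leq_trans (size_polyMleq _ _) _.
  by apply: leq_trans (leq_pred _) _; apply: leq_add; apply: size_poly.
by apply: eq_bigr => i _; rewrite expr1n mulr1 exp_polyD.
Qed.

Lemma nilpotent0 : nilpotent (0 : A).
Proof. by exists 1%N; rewrite expr1. Qed.

Lemma nilpotentZ (r : R[i]) a : nilpotent a -> nilpotent (r *: a).
Proof. by move=> [n an]; exists n; rewrite exprZn an scaler0. Qed.

Lemma nilexp0 : nilexp (0 : A) = 1.
Proof.
by rewrite (@nilexpE 0 1) ?expr1 // big_ord1 /e fact0 expr0 invr1 scale1r.
Qed.

Lemma expi2piD (r q : R) : expi2pi (r + q) = expi2pi r * expi2pi q.
Proof.
rewrite /expi2pi mulrDr cosD sinD; apply/eqP; rewrite eq_complex /=.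
by rewrite eqxx /= [X in X == _]addrC eqxx.
Qed.

Lemma expi2pi0 : expi2pi (0 : R) = 1.
Proof. by rewrite /expi2pi mulr0 cos0 sin0. Qed.

Variables (k : lieAlgType R) (t : {vspace k}) (x : even_form t A).
Local Notation D := ('Hom(subvs_of t, R^o)).

Lemma soul_at_nilpotent (l : D) : nilpotent (soul_at x l).
Proof.
rewrite /soul_at big_seq; elim/big_ind: _ => [|a b|p px].
- exact: nilpotent0.
- exact: nilpotentD.
by apply/nilpotentZ/(soul_nilpotent (e := x)).
Qed.

Lemma zexpD (l l' : D) : zexp x (l + l') = zexp x l * zexp x l'.
Proof.
rewrite /zexp add_lfunE expi2piD.
have -> : soul_at x (l + l') = soul_at x l + soul_at x l'.
  rewrite /soul_at -big_split; apply: eq_bigr => p _.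
  by rewrite add_lfunE rmorphD scalerDl.
rewrite scalerDr nilexpD; [|by apply/nilpotentZ/soul_at_nilpotent..].
by rewrite -scalerAl -scalerAr scalerA.
Qed.

Lemma zexp0 : zexp x (0 : D) = 1.
Proof.
rewrite /zexp zero_lfunE expi2pi0 scale1r.
have -> : soul_at x 0 = 0.
  by rewrite /soul_at big1 // => p _; rewrite zero_lfunE rmorph0 scale0r.
by rewrite scaler0 nilexp0.
Qed.

End NilpotentExponential.

(** * The identity *)

Section Chamber.
Variables (R : realType) (k : lieAlgType R) (B : k -> k -> R) (t : {vspace k}).
Hypotheses (BI : invariant_inner_product B) (tC : cartan_subalgebra t).
Hypothesis kS : semisimple_lie k.
Variable h0 : subvs_of t.
Hypothesis h0_regular : regular_point h0.
Local Notation D := ('Hom(subvs_of t, R^o)).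

Definition chamber_form (l : D) : R := l h0.
Local Notation Phi := (root_fset t).
Local Notation ip := (@dual_ip R k B t).

Lemma chamber_form_regular : regular_form Phi chamber_form.
Proof.
split=> [r x y | a /root_fsetP /h0_regular //].
by rewrite /chamber_form add_lfunE scale_lfunE.
Qed.

Let rsP := compact_root_system BI tC kS.
Let evP := chamber_form_regular.

Lemma pos_rootsP a : pos_roots h0 a <-> a \in Pos Phi chamber_form.
Proof.
rewrite in_Pos; split=> [[/root_fsetP -> a0] | /andP[/root_fsetP aR a0]] //.
Qed.

Lemma simple_rootsP a : simple_roots h0 a <-> a \in Simple Phi chamber_form.
Proof.
split=> [[/pos_rootsP aP aS] | /SimpleP[aP aS]].
  apply/SimpleP; split=> // -[b [c [bP cP abc]]]; apply: aS; exists b, c.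
  by split=> //; apply/pos_rootsP.
split; first exact/pos_rootsP.
move=> [b [c [bP cP abc]]]; apply: aS; exists b, c.
by split=> //; apply/pos_rootsP.
Qed.

Lemma fset_set_eq (V : choiceType) (S : set V) (X : {fset V}) :
  (forall a, S a <-> a \in X) -> fset_set S = X.
Proof.
move=> SX; have -> : S = [set` X].
  by apply/seteqP; split=> a /= /SX.
by rewrite set_fsetK.
Qed.

Lemma Simple_root a : a \in Simple Phi chamber_form -> Defs.roots t a.
Proof. by move/Simple_Phi/root_fsetP. Qed.

(** A weight is determined by its values on the simple coroots. *)
Lemma fund_weightsP l : fund_weights h0 l <-> l \in fund ip Phi chamber_form.
Proof.
split=> [[a [/simple_rootsP aS la lb]] | /imfsetP[a /= aS ->]].
  apply/imfsetP; exists a; first exact: aS.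
  apply: (cart_inj rsP evP) => b bS.
  rewrite (fund_weightE rsP evP aS bS) -(coroot_cart BI tC _ (Simple_root bS)).
  have [-> | ba] := eqVneq b a; first exact: la.
  exact: lb (proj2 (simple_rootsP b) bS) ba.
exists a; split; first exact: (proj2 (simple_rootsP a) aS).
  by rewrite (coroot_cart BI tC _ (Simple_root aS)) (fund_weightE rsP evP aS aS) eqxx.
move=> b /simple_rootsP bS ba.
by rewrite (coroot_cart BI tC _ (Simple_root bS)) (fund_weightE rsP evP aS bS) (negPf ba).
Qed.

Lemma weyl_groupP w : weyl_group t w <-> weyl ip Phi w.
Proof.
split; last change (weyl ip Phi w -> in_weyl w); elim=> [|a v aP _ IH].
- exact: weyl1.
- rewrite (reflection_srefl BI tC aP); apply: weylM IH.
  exact: (proj2 (root_fsetP a) aP).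
- exact: in_weyl1.
have aR := proj1 (root_fsetP a) aP.
rewrite -(reflection_srefl BI tC aR); exact: in_weylM aR IH.
Qed.

End Chamber.

Theorem proposition6p1 (R : realType) (k : lieAlgType R)
    (k_nontrivial : (0 < \dim {:k})%N)
    (k_compact : compact_lie k) (k_semisimple : semisimple_lie k)
    (t : {vspace k}) (t_cartan : cartan_subalgebra t)
    (h0 : subvs_of t) (h0_regular : regular_point h0)
    (A : comUnitAlgType R[i]) (x y : even_form t A)
    (unit_z : forall a, pos_roots h0 a -> 1 - zexp x (- a) \is a GRing.unit)
    (unit_z1 : forall a, pos_roots h0 a -> 1 - zexp y (- a) \is a GRing.unit)
    (unit_zz1 : forall w v l,
       weyl_group t w -> weyl_group t v -> fund_weights h0 l ->
       1 - zexp x (- w l) * zexp y (- v l) \is a GRing.unit) :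
  (zexp x (rho h0) * zexp y (rho h0) *
     \prod_(a <- fset_set (pos_roots h0)) ((1 - zexp x (- a)) * (1 - zexp y (- a))))^-1 *
  (\sum_(w <- fset_set (weyl_group t)) \sum_(v <- fset_set (weyl_group t))
     (((-1) ^+ num_simple h0 * weyl_sign w * weyl_sign v)%:C%:A /
      \prod_(l <- fset_set (fund_weights h0)) (1 - zexp x (- w l) * zexp y (- v l))))
  = \sum_(w <- fset_set (weyl_group t)) \sum_(v <- fset_set (weyl_group t))
      (\prod_(a <- fset_set (pos_roots h0)) (1 - zexp x (- w a)) *
       \prod_(l <- fset_set (fund_weights h0)) (1 - zexp x (w l) * zexp y (v l)) *
       \prod_(a <- fset_set (pos_roots h0)) (1 - zexp y (- v a)))^-1
  /\
  \sum_(w <- fset_set (weyl_group t)) \sum_(v <- fset_set (weyl_group t))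
      (\prod_(a <- fset_set (pos_roots h0)) (1 - zexp x (- w a)) *
       \prod_(l <- fset_set (fund_weights h0)) (1 - zexp x (w l) * zexp y (v l)) *
       \prod_(a <- fset_set (pos_roots h0)) (1 - zexp y (- v a)))^-1 = 0.
Proof.
have [B BI] := k_compact.
have rsP := compact_root_system BI t_cartan k_semisimple.
have evP := chamber_form_regular h0_regular.
set ip := @dual_ip R k B t in rsP; set ev := chamber_form h0 in evP.
have PosE : fset_set (pos_roots h0) = Pos (root_fset t) ev.
  by apply: fset_set_eq; apply: pos_rootsP.
have SimpleE : fset_set (simple_roots h0) = Simple (root_fset t) ev.
  by apply: fset_set_eq; apply: simple_rootsP.
have fundE : fset_set (fund_weights h0) = fund ip (root_fset t) ev.
  by apply: fset_set_eq; apply: (fund_weightsP BI t_cartan k_semisimple h0_regular).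
have WE : fset_set (weyl_group t) = W ip (root_fset t).
  rewrite /W; congr (fset_set _); apply/seteqP; split=> w wW.
    exact: (proj1 (weyl_groupP BI t_cartan w) wW).
  exact: (proj2 (weyl_groupP BI t_cartan w) wW).
have rhoE : rho h0 = weyl_vector (root_fset t) ev by rewrite /rho PosE.
rewrite /num_simple SimpleE rhoE PosE fundE WE.
have posP a : a \in Pos (root_fset t) ev -> pos_roots h0 a.
  by move/pos_rootsP.
apply: (@weyl_double_sum R _ ip (root_fset t) ev rsP evP A (in_alg A \o real_complex R)).
- exact: zexp0.
- exact: zexpD.
- exact: zexp0.
- exact: zexpD.
- by move=> a /posP; apply: unit_z.
- by move=> a /posP; apply: unit_z1.
- move=> w v a wW vW aS; apply: unit_zz1; try exact/(weyl_groupP BI t_cartan).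
  apply/(fund_weightsP BI t_cartan k_semisimple h0_regular).
  by apply/imfsetP; exists a.
exact: (roots_nonempty BI t_cartan k_semisimple k_nontrivial).
Qed.
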